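(* Let $V$ be a leafless directed tree (rooted or unrooted). Let $X=\ell^p(V)$ with $1\le p<\infty$, or $X=c_0(V)$. (i) There exists a mixing weighted backward shift on $X$ that supports a dense, countably generated, free hypercyclic algebra. (ii) There exists a non-mixing weighted backward shift on $X$ that supports a dense, countably generated, free hypercyclic algebra.
   Context: All scalars are complex. A directed tree is a connected directed graph $(V,E)$ with countable vertex set $V$ and edge set $E\subset\{(a,b)\in V\times V: a\ne b\}$, having no cycles, and such that each vertex $b$ has at most one parent, i.e. a vertex $a$ with $(a,b)\in E$. There is at most one vertex without a parent, called the root; the tree is rooted if it has a root, unrooted otherwise. $\mathrm{Chi}(v)$ is the set of children of $v$ (vertices whose parent is $v$). The tree is leafless if every vertex has at least one child (possibly infinitely many). A weight is a family $\lambda=(\lambda_v)_{v\in V}$ of non-zero scalars. The weighted backward shift with weight $\lambda$ is $(B_\lambda f)(v)=\sum_{u\in\mathrm{Chi}(v)}\lambda_uf(u)$, $v\in V$; a weighted backward shift on $X$ means one that is a bounded operator $X\to X$. $\ell^p(V)$ is the space of $f\in\mathbb{C}^V$ with $\|f\|_p=(\sum_{v\in V}|f(v)|^p)^{1/p}<\infty$; $c_0(V)$ is the space of $f\in\mathbb{C}^V$ such that for every $\varepsilon>0$ there is a finite $F\subset V$ with $|f(v)|<\varepsilon$ for all $v\in V\setminus F$, with the sup norm. Both are Banach algebras for the coordinatewise product $(fg)(v)=f(v)g(v)$. A bounded operator $T$ on $X$ is mixing if for all non-empty open $U,W\subset X$ there is $N\ge 0$ with $T^k(U)\cap W\ne\varnothing$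 for all $k\ge N$. $HC(T)$ is the set of hypercyclic vectors of $T$, i.e. vectors $x$ whose orbit $\{T^nx:n\ge0\}$ is dense. A hypercyclic algebra for $T$ is a subalgebra, not $\{0\}$, contained in $HC(T)\cup\{0\}$. It is dense if it is dense in the whole space, and countably generated and free if it is generated by a countably infinite set $G$ that is algebraically independent: $P(g_1,\dots,g_d)\ne0$ for all $d\geq 1$, distinct $g_1,\dots,g_d\in G$ and every non-zero polynomial $P$ in $d$ commuting variables without constant term. *)

(* Defs.v *)
From HB Require Import structures.
From mathcomp Require Import all_boot all_order all_algebra.
From mathcomp Require Import all_classical all_reals all_analysis.
From mathcomp Require Import complex ring.
From mathcomp Require summability mpoly.
Import (canonicals, coercions) mpoly.
Set Implicit Arguments.
Unset Strict Implicit.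
Unset Printing Implicit Defensive.
Import Order.TTheory GRing.Theory Num.Theory.
Import numFieldNormedType.Exports.
Import Normc.

Local Open Scope classical_set_scope.
Local Open Scope ring_scope.
Local Open Scope complex_scope.

(* A relation [E a b] stands for the edge (a, b): [a] is the parent of [b].
   Connectedness refers to the underlying undirected graph.  That at most one
   vertex has no parent follows from these axioms. *)
Record directed_tree (V : countType) (E : rel V) : Prop := DirectedTree {
  dtree_nonempty : [set: V] !=set0;
  dtree_irreflexive : irreflexive E;
  dtree_connected : forall a b : V, exists s : seq V,
    path (fun x y => E x y || E y x) a s /\ last a s = b;
  dtree_acyclic : forall c : seq V, cycle E c -> c = [::];
  dtree_parent_unique : forall a a' b : V, E a b -> E a' b -> a = a'
}.

Definition leafless (V : countType) (E : rel V) : Prop :=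
  forall v : V, exists u : V, E v u.

Variant space_kind (R : realType) := Lp (p : R) of 1 <= p | C0.
Arguments C0 {R}.

Section Spaces.
Context (R : realType) (V : countType).
Implicit Types (f g : V -> R[i]) (p c M : R).

Definition lp_sum p f : \bar R := \esum_(v in [set: V]) (normc (f v) `^ p)%:E.

Definition lp_set p : set (V -> R[i]) := [set f | (lp_sum p f < +oo)%E].
Definition lp_norm p f : R := (fine (lp_sum p f)) `^ p^-1.

Definition c0_set : set (V -> R[i]) := [set f | forall eps : R, 0 < eps ->
  exists2 F : set V, finite_set F & forall v, ~ F v -> normc (f v) < eps].
Definition sup_norm f : R := sup (range (fun v => normc (f v))).

Definition space_set (s : space_kind R) : set (V -> R[i]) :=
  match s with Lp p _ => lp_set p | C0 => c0_set end.
Definition space_pred s : {pred V -> R[i]} := mem (space_set s).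
Definition space_norm (s : space_kind R) (f : V -> R[i]) : R :=
  match s with Lp p _ => lp_norm p f | C0 => sup_norm f end.

Lemma normc_ge0 (z : R[i]) : 0 <= normc z.
Proof. by case: z => a b; exact: sqrtr_ge0. Qed.

Lemma normc_norm (z : R[i]) : (normc z)%:C = `|z|.
Proof. by []. Qed.

Lemma lp_sum_ge0 p f : (0 <= lp_sum p f)%E.
Proof. by apply: esum_ge0 => v _; rewrite lee_fin powR_ge0. Qed.

Lemma lp_sum_ge p f v : ((normc (f v) `^ p)%:E <= lp_sum p f)%E.
Proof.
apply: esum_ge; exists [set v]; first by split => //; exact: finite_set1.
by rewrite fsbig_set1.
Qed.

Lemma ge0_le_esumZ (a : V -> R) c : 0 <= c -> (forall v, 0 <= a v) ->
  (\esum_(v in [set: V]) (c * a v)%:E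
    <= c%:E * \esum_(v in [set: V]) (a v)%:E)%E.
Proof.
move=> c0 a0; apply: ge_ereal_sup => _ [F FT <-].
under eq_fsbigr do rewrite EFinM.
rewrite -ge0_mule_fsumr => [|v]; last by rewrite lee_fin.
by apply: lee_wpmul2l; [rewrite lee_fin | apply: esum_ge; exists F].
Qed.

Lemma lp_sum_fineK p f : lp_set p f -> lp_sum p f = (fine (lp_sum p f))%:E.
Proof. by move=> fp; rewrite fineK// ge0_fin_numE// lp_sum_ge0. Qed.

Lemma lp_norm_ge0 p f : 0 <= lp_norm p f.
Proof. exact: powR_ge0. Qed.

Lemma lp_normK p f : 1 <= p -> lp_set p f ->
  ((lp_norm p f `^ p)%:E = lp_sum p f)%E.
Proof.
move=> p1 fp; have p0 : 0 < p by exact: lt_le_trans p1.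
by rewrite -powRrM mulVf ?gt_eqF// powRr1 ?fine_ge0 ?lp_sum_ge0// -lp_sum_fineK.
Qed.

Lemma lp_norm_le p f M : 1 <= p -> 0 <= M ->
  (lp_sum p f <= (M `^ p)%:E)%E -> lp_norm p f <= M.
Proof.
move=> p1 M0 fM; have p0 : 0 < p by exact: lt_le_trans p1.
have fp : lp_set p f by exact: le_lt_trans fM (ltry _).
move: fM; rewrite lp_sum_fineK// lee_fin => fM.
rewrite /lp_norm -[leRHS]powRr1// -(mulfV (lt0r_neq0 p0)) powRrM.
by rewrite ge0_ler_powR ?invr_ge0 ?(ltW p0)// nnegrE ?powR_ge0// fine_ge0 ?lp_sum_ge0.
Qed.

Lemma le_lp_norm p f v : 1 <= p -> lp_set p f -> normc (f v) <= lp_norm p f.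
Proof.
move=> p1 fp; have p0 : 0 < p by exact: lt_le_trans p1.
have := lp_sum_ge p f v; rewrite -lp_normK// lee_fin => h.
rewrite leNgt; apply/negP => lt; move: h; apply/negP; rewrite -ltNge.
by rewrite gt0_ltr_powR// nnegrE ?lp_norm_ge0 ?normc_ge0.
Qed.

Lemma powRD_le p (a b x y : R) : 1 <= p -> 0 < a -> 0 < b -> 0 <= x -> 0 <= y ->
  (x + y) `^ p <= (a + b) `^ p * (a / (a + b) * a^-1 `^ p) * x `^ p
                + (a + b) `^ p * (b / (a + b) * b^-1 `^ p) * y `^ p.
Proof.
move=> p1 a0 b0 x0 y0.
have ab0 : 0 < a + b by exact: addr_gt0.
have t0 : 0 <= a / (a + b) by rewrite divr_ge0 ?ltW.
have t1 : a / (a + b) <= 1 by rewrite ler_pdivrMr// mul1r lerDl ltW.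
have tE : 1 - a / (a + b) = b / (a + b).
  by rewrite -[1](divff (lt0r_neq0 ab0)) -mulrBl addrAC subrr add0r.
have := convex_powR p1 (Itv01 t0 t1) (x := x / a) (y := y / b).
rewrite !inE /= !in_itv /= !andbT !divr_ge0 ?(ltW a0) ?(ltW b0)// => /(_ isT isT).
rewrite !convRE /= /unstable.onem tE.
have cE : a / (a + b) * (x / a) + (1 - a / (a + b)) * (y / b)
    = (a + b)^-1 * (x + y).
  by field; rewrite !lt0r_neq0.
rewrite [conv _ _ _](_ : _ = (a + b)^-1 * (x + y)); last exact: cE.
rewrite [((a + b)^-1 * _) `^ _]powRM ?invr_ge0 ?(ltW ab0) ?addr_ge0// => h.
have := ler_wpM2l (powR_ge0 (a + b) p) h.
rewrite (mulrA _ ((a + b)^-1 `^ p)) [X in X * _ <= _](_ : _ = 1) ?mul1r; last first.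
  by rewrite -powRM ?invr_ge0 ?(ltW ab0)// divff ?lt0r_neq0// powR1.
move=> /le_trans; apply.
rewrite !powRM ?invr_ge0 ?(ltW a0) ?(ltW b0)//.
by rewrite le_eqVlt; apply/orP; left; apply/eqP; ring.
Qed.

Lemma lp_sumD_le p f g (a b : R) : 1 <= p -> 0 < a -> 0 < b ->
  (lp_sum p (f + g)%R <=
     ((a + b) `^ p * (a / (a + b) * a^-1 `^ p))%R%:E * lp_sum p f +
     ((a + b) `^ p * (b / (a + b) * b^-1 `^ p))%R%:E * lp_sum p g)%E.
Proof.
move=> p1 a0 b0.
set c := (X in (X%:E * lp_sum p f)%E); set d := (X in (_ + X%:E * _)%E).
have c0 : 0 <= c by rewrite !mulr_ge0 ?powR_ge0 ?invr_ge0 ?addr_ge0 ?ltW.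
have d0 : 0 <= d by rewrite !mulr_ge0 ?powR_ge0 ?invr_ge0 ?addr_ge0 ?ltW.
apply: (@le_trans _ _ (\esum_(v in [set: V])
   ((c * normc (f v) `^ p)%:E + (d * normc (g v) `^ p)%:E))%E).
  apply: le_esum => v _; rewrite -EFinD lee_fin.
  apply: le_trans (powRD_le p1 a0 b0 (normc_ge0 _) (normc_ge0 _)).
  rewrite ge0_ler_powR ?nnegrE ?addr_ge0 ?normc_ge0//.
    exact: le_trans p1.
  exact: le_normcD.
rewrite esumD => [|v _|v _]; [|by rewrite lee_fin mulr_ge0 ?powR_ge0..].
by apply: leeD; apply: ge0_le_esumZ => // v; exact: powR_ge0.
Qed.

Lemma lp_sumZ_le p f (z : R[i]) : 1 <= p ->
  (lp_sum p (z *: f) <= (normc z `^ p)%:E * lp_sum p f)%E.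
Proof.
move=> p1; rewrite /lp_sum; under eq_esum do
  rewrite [(z *: f) _]/(z * f _) normcM powRM ?normc_ge0//.
by apply: ge0_le_esumZ => [|v]; exact: powR_ge0.
Qed.

Lemma lp_sum0 p : 1 <= p -> lp_sum p (0 : V -> R[i]) = 0%E.
Proof.
move=> p1; apply: esum1 => v _; rewrite [X in normc X]/(0 : R[i]) normc0 powR0//.
by rewrite gt_eqF// (lt_le_trans _ p1).
Qed.

Lemma lp_normZ_le p f (z : R[i]) : 1 <= p -> lp_set p f ->
  lp_norm p (z *: f) <= normc z * lp_norm p f.
Proof.
move=> p1 fp; apply: lp_norm_le => //; first by rewrite mulr_ge0 ?normc_ge0 ?lp_norm_ge0.
rewrite powRM ?normc_ge0 ?lp_norm_ge0// EFinM lp_normK//.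
exact: lp_sumZ_le.
Qed.

Lemma lp_norm_eq0 p f : 1 <= p -> lp_set p f -> lp_norm p f = 0 -> f = 0.
Proof.
move=> p1 fp f0; apply/funext => v; apply: eq0_normc.
by apply/eqP; rewrite eq_le normc_ge0 -f0 le_lp_norm.
Qed.

Lemma lp_normD_le p f g : 1 <= p -> lp_set p f -> lp_set p g ->
  lp_norm p (f + g) <= lp_norm p f + lp_norm p g.
Proof.
move=> p1 fp gp.
have [f0|f0] := eqVneq (lp_norm p f) 0.
  by rewrite (lp_norm_eq0 p1 fp f0) add0r lerDr lp_norm_ge0.
have [g0|g0] := eqVneq (lp_norm p g) 0.
  by rewrite (lp_norm_eq0 p1 gp g0) addr0 lerDl lp_norm_ge0.
have a0 : 0 < lp_norm p f by rewrite lt0r f0 lp_norm_ge0.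
have b0 : 0 < lp_norm p g by rewrite lt0r g0 lp_norm_ge0.
apply: lp_norm_le => //; first by rewrite addr_ge0 ?lp_norm_ge0.
apply: le_trans (lp_sumD_le f g p1 a0 b0) _.
move: (lp_norm p f) (lp_norm p g) (lp_normK p1 fp) (lp_normK p1 gp) a0 b0
  => a b <- <- a0 b0.
have abp c : 0 < c -> c^-1 `^ p * c `^ p = 1.
  by move=> c0; rewrite -powRM ?invr_ge0 ?ltW// mulVf ?lt0r_neq0// powR1.
rewrite -!EFinM -EFinD lee_fin -!mulrA !abp// !mulr1 -mulrDr.
by rewrite -mulrDl divff ?mulr1// lt0r_neq0// addr_gt0.
Qed.

Lemma lp_setM p f g : 1 <= p -> lp_set p f -> lp_set p g ->
  lp_set p (fun v => f v * g v).
Proof.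
move=> p1 fp gp; apply: (@le_lt_trans _ _ ((lp_norm p f `^ p)%:E * lp_sum p g)%E).
  rewrite /lp_sum; apply: le_trans (ge0_le_esumZ (powR_ge0 _ _) _) => [|v];
    last exact: powR_ge0.
  apply: le_esum => v _; rewrite lee_fin normcM powRM ?normc_ge0//.
  rewrite ler_wpM2r ?powR_ge0// ge0_ler_powR ?nnegrE ?normc_ge0 ?lp_norm_ge0//.
    exact: le_trans p1.
  exact: le_lp_norm.
by rewrite lp_sum_fineK// -EFinM ltry.
Qed.

Lemma c0_bounded f : c0_set f -> exists2 M, 0 <= M & forall v, normc (f v) <= M.
Proof.
move=> /(_ 1 ltr01)[F /finite_seqP[A ->{F}] FA].
exists (1 + \sum_(v <- A) normc (f v)) => [|v].
  by rewrite addr_ge0// sumr_ge0// => v _; exact: normc_ge0.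
have [vA|/negP vA] := boolP (v \in A); last first.
  by rewrite (le_trans (ltW (FA _ vA)))// lerDl sumr_ge0// => *; exact: normc_ge0.
rewrite (big_rem v)//= addrCA lerDl addr_ge0// sumr_ge0// => *.
exact: normc_ge0.
Qed.

Lemma sup_norm_ge f v : c0_set f -> normc (f v) <= sup_norm f.
Proof.
move=> /c0_bounded[M _ fM]; apply: ub_le_sup; last by exists v.
by exists M => _ [u _ <-].
Qed.

Lemma sup_norm_le f M : 0 <= M -> (forall v, normc (f v) <= M) -> sup_norm f <= M.
Proof.
move=> M0 fM; have [/set0P ne|/negPn/eqP] := boolP (range (fun v => normc (f v)) != set0).
  by apply: ge_sup => // _ [v _ <-].
by rewrite /sup_norm => ->; rewrite sup0.
Qed.

Lemma sup_norm_ge0 f : c0_set f -> 0 <= sup_norm f.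
Proof.
move=> fc; have [/set0P[? [v _ _]]|/negPn/eqP] :=
  boolP (range (fun v => normc (f v)) != set0).
  exact: le_trans (normc_ge0 _) (sup_norm_ge v fc).
by rewrite /sup_norm => ->; rewrite sup0.
Qed.

Lemma c0_setD f g : c0_set f -> c0_set g -> c0_set (f + g).
Proof.
move=> fc gc e e0; have e20 : 0 < e / 2 by rewrite divr_gt0.
have [F finF fF] := fc _ e20; have [G finG gG] := gc _ e20.
exists (F `|` G); first by rewrite finite_setU.
move=> v /not_orP[Fv Gv]; rewrite (le_lt_trans (le_normcD _ _))//.
by rewrite [ltRHS]splitr ltrD ?fF ?gG.
Qed.

Lemma c0_setM_bounded f g M : (forall v, normc (f v) <= M) -> c0_set g ->
  c0_set (fun v => f v * g v).
Proof.
move=> fM gc e e0; have M0 : 0 < `|M| + 1 by rewrite ltr_wpDl.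
have [F finF gF] := gc (e / (`|M| + 1)) (divr_gt0 e0 M0).
exists F => // v Fv; rewrite normcM.
have fv : normc (f v) <= `|M| + 1.
  by rewrite (le_trans (fM v))// (le_trans (ler_norm _))// lerDl.
rewrite (le_lt_trans (ler_wpM2r (normc_ge0 _) fv))// mulrC -ltr_pdivlMr//.
exact: gF.
Qed.

Lemma space_predP s f : f \in space_pred s <-> space_set s f.
Proof. by split => [/set_mem|/mem_set]. Qed.

Lemma space_set_submod s : GRing.submod_closed (space_pred s).
Proof.
split=> [|z f g /space_predP fs /space_predP gs]; apply/space_predP.
  case: s => [p p1|] /=; first by rewrite /lp_set /= lp_sum0 ?ltry.
  by move=> e e0; exists set0 => // v _; rewrite [X in normc X]/(0 : R[i]) normc0.
case: s fs gs => [p p1|] /= fs gs.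
  have zf : lp_set p (z *: f).
    by apply: le_lt_trans (lp_sumZ_le f z p1) _; rewrite lp_sum_fineK// -EFinM ltry.
  apply: le_lt_trans (lp_sumD_le _ _ p1 ltr01 ltr01) _.
  by rewrite (lp_sum_fineK zf) (lp_sum_fineK gs) -!EFinM -EFinD ltry.
by apply: c0_setD => //; exact: (c0_setM_bounded (f := fun=> z)).
Qed.

Lemma space_setM s f g : space_set s f -> space_set s g ->
  space_set s (fun v => f v * g v).
Proof.
case: s => [p p1|] /=; first exact: lp_setM.
by move=> /c0_bounded[M _ fM]; exact: c0_setM_bounded fM.
Qed.

Lemma space_normD s f g : space_set s f -> space_set s g ->
  space_norm s (f + g) <= space_norm s f + space_norm s g.
Proof.
case: s => [p p1|] /=; first exact: lp_normD_le.
move=> fc gc; apply: sup_norm_le => [|v]; first by rewrite addr_ge0 ?sup_norm_ge0.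
by rewrite (le_trans (le_normcD _ _))// lerD ?sup_norm_ge.
Qed.

Lemma space_normZ_le s f (z : R[i]) : space_set s f ->
  space_norm s (z *: f) <= normc z * space_norm s f.
Proof.
case: s => [p p1|] /=; first exact: lp_normZ_le.
move=> fc; apply: sup_norm_le => [|v].
  by rewrite mulr_ge0 ?normc_ge0 ?sup_norm_ge0.
by rewrite normcM ler_wpM2l ?normc_ge0 ?sup_norm_ge.
Qed.

Lemma space_norm_ge0 s f : space_set s f -> 0 <= space_norm s f.
Proof. by case: s => [p p1 _|] /=; [exact: lp_norm_ge0 | exact: sup_norm_ge0]. Qed.

Lemma space_norm_eq0 s f : space_set s f -> space_norm s f = 0 -> f = 0.
Proof.
case: s => [p p1|] /=; first exact: lp_norm_eq0.
move=> fc f0; apply/funext => v; apply: eq0_normc.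
by apply/eqP; rewrite eq_le normc_ge0 -f0 sup_norm_ge.
Qed.

End Spaces.

Record tree_space (R : realType) (V : countType) (s : space_kind R) := TreeSpace {
  space_fun :> V -> R[i];
  space_funP : space_fun \in space_pred s
}.

Section SpaceTheory.
Context (R : realType) (V : countType) (s : space_kind R).

HB.instance Definition _ := [isSub for @space_fun R V s].
HB.instance Definition _ := [Choice of @tree_space R V s by <:].
HB.instance Definition _ :=
  GRing.isSubmodClosed.Build R[i] (V -> R[i]) (space_pred s)
    (space_set_submod V s).
HB.instance Definition _ :=
  [SubChoice_isSubLmodule of @tree_space R V s by <:].

Implicit Types f g : tree_space V s.

Lemma space_fun_set f : space_set s f.
Proof. exact/space_predP/space_funP. Qed.

(* MathComp normed modules over R[i] have an R[i]-valued norm. *)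
Definition norm_space f : R[i] := (space_norm s f)%:C.

Lemma norm_spaceD f g : norm_space (f + g) <= norm_space f + norm_space g.
Proof. by rewrite -rmorphD/= lecR space_normD//; exact: space_fun_set. Qed.

Lemma norm_space_eq0 f : norm_space f = 0 -> f = 0.
Proof.
by case=> /(space_norm_eq0 (space_fun_set f)) f0; exact: val_inj.
Qed.

Lemma norm_spaceZ (z : R[i]) f : norm_space (z *: f) = `|z| * norm_space f.
Proof.
have le w h : norm_space (w *: h) <= `|w| * norm_space h.
  by rewrite -normc_norm -rmorphM/= lecR space_normZ_le//; exact: space_fun_set.
apply/eqP; rewrite eq_le le/=.
have [->|z0] := eqVneq z 0.
  by rewrite normr0 mul0r lecR space_norm_ge0//; exact: space_fun_set.
rewrite -ler_pdivlMl ?normr_gt0// -normfV.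
by have := le z^-1 (z *: f); rewrite scalerA mulVf// scale1r.
Qed.

HB.instance Definition _ := Lmodule_isNormed.Build R[i] (tree_space V s)
  norm_spaceD norm_spaceZ norm_space_eq0.

Definition space_mul f g : tree_space V s :=
  TreeSpace (proj2 (space_predP s _) (space_setM (space_fun_set f) (space_fun_set g))).

End SpaceTheory.

Definition mixing (X : topologicalType) (T : X -> X) : Prop :=
  forall U W : set X, open U -> open W -> U !=set0 -> W !=set0 ->
    exists N : nat, forall k : nat, (N <= k)%N ->
      (iter k T @` U) `&` W !=set0.

Definition hypercyclic_vectors (X : topologicalType) (T : X -> X) : set X :=
  [set x | dense (range (fun n => iter n T x))].

(* [lam u] is only relevant on vertices [u] having a parent.  The sum over the
   possibly infinite set of children of [v] is an unordered sum: the limit of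
   the finite partial sums along the filter of finite sets of vertices.  For a
   linear map, [bounded_near T (nbhs 0)] is boundedness, see
   [linear_boundedP]. *)
Record weighted_backward_shift (R : realType) (V : countType) (E : rel V)
    (s : space_kind R) (lam : V -> R[i])
    (T : {linear tree_space V s -> tree_space V s}) : Prop := WeightedBackwardShift {
  wbs_neq0 : forall v, lam v != 0;
  wbs_bounded : bounded_near T (nbhs 0);
  wbs_sum : forall (f : tree_space V s) (v : V),
    summability.partial_sum
      (fun u => (if E v u then lam u * f u else 0) : R[i]^o)
      @ summability.totally --> (T f v : R[i]^o)
}.

Section Algebras.
Context (R : realType) (V : countType) (s : space_kind R).
Let X := tree_space V s.

Definition subalgebra (A : set X) : Prop :=
  [/\ A 0,
      forall (z : R[i]) f g, A f -> A g -> A (z *: f + g) &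
      forall f g, A f -> A g -> A (space_mul f g)].

Definition generated_algebra (G : set X) : set X := smallest subalgebra G.

(* A polynomial without constant term is evaluated at elements of X pointwise,
   as the operations of X are pointwise. *)
Definition algebraically_independent (G : set X) : Prop :=
  forall (d : nat) (g : 'I_d -> X), (0 < d)%N -> injective g ->
    (forall i, G (g i)) ->
  forall P : mpoly.mpoly d R[i], mpoly.mcoeff mpoly.mnm0 P = 0 -> P != 0 ->
    (fun v : V => mpoly.meval (fun i => g i v) P) <> (fun=> 0).

Definition hypercyclic_algebra (T : X -> X) (A : set X) : Prop :=
  [/\ subalgebra A, A <> [set 0] & A `<=` hypercyclic_vectors T `|` [set 0]].

Definition countably_generated_free (A : set X) : Prop :=
  exists G : set X,
    [/\ (G #= [set: nat])%card, algebraically_independent G &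
        A = generated_algebra G].

Definition supports_dense_free_hypercyclic_algebra (T : X -> X) : Prop :=
  exists A : set X,
    [/\ hypercyclic_algebra T A, dense A & countably_generated_free A].

End Algebras.

(* Main.v *)
From HB Require Import structures.
Require Import Defs.
From mathcomp Require Import all_boot all_order all_algebra.
From mathcomp Require Import all_classical all_reals all_analysis.
From mathcomp Require Import finmap complex ring lra zify.
From mathcomp Require summability mpoly.
Import (canonicals, coercions) mpoly.
Set Implicit Arguments.
Unset Strict Implicit.
Unset Printing Implicit Defensive.
Import Order.TTheory GRing.Theory Num.Theory.
Import numFieldNormedType.Exports.
Import Normc.

(** Fix a vertex [v0] and give every vertex a preferred child, which for a
    strict ancestor of [v0] is the one on the way down to [v0].  The weight is
    1/2 on [v0] and its ancestors; elsewhere it is [4 * d k / d k'], where [k]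
    and [k'] are the depths below [v0] of the parent and of the vertex (0
    outside the subtree of [v0]), times a summable factor when the vertex is
    not a preferred child.  The profile [d >= 1] is nondecreasing and remains
    to be chosen.  The weights in each set of children have a sum bounded
    independently of the set, which makes the shift [T] bounded on
    every space under consideration ([exists_shift]).  Let [path_wt n u] be the
    product of the weights of the first [n] vertices on the way up from [u], so
    that [T^n] maps the point mass at [u] to [path_wt n u] times the point
    mass at the [n]-th ancestor of [u].  Two estimates drive the dynamics:
    - [path_wt n u] tends to 0 for each [u], because by connectedness the way
      up from [u] meets the line of ancestors of [v0], or leaves the tree
      ([path_wt_to0]);
    - along preferred children started at [v] the products grow like
      [4^n / d (J + n)], since they telescope ([path_wt_branch]).

    With [d = 1] the growth holds for all large [n], and perturbing a vector by
    small values at the [n]-th preferred descendants gives mixing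
    ([shift_mixing]).  With [d n = 8^(2^i)], [i] the integer part of the binary
    logarithm of [n], the growth still holds along some times, but at the times
    [n = 2^i] all paths ending at [v0] together contribute at most [d 0]
    times the norm, which excludes mixing ([iter_shift_coord]).

    The algebra only uses that the growth is unbounded along some times.  Its
    generators are [G_i = y_i + sum_(k > i) b_k^(D_k^i)] with finitely
    supported bumps [b_k] on pairwise disjoint blocks; [y_k], [D_k] and a
    degree [m_k] run through a countable family, each triple occurring
    infinitely often, and the [y_k] are dense.  The block of [b_k] consists of
    the [n_k]-th preferred descendants of the support of [y_k], where
    [path_wt * b_k^m_k = y_k].  A polynomial in the generators equals
    [q(b_k)] on that block, where [q(t)] is its value at the powers
    [t^(D_k^i)]; for a large base [D_k] distinct monomials become distinct
    powers of [t] (Kronecker substitution), so that [q] is not 0.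
    If [c t^m] is the lowest term of [q] and [m_k = m], then [T^n_k] maps the
    block part nearly to [c y_k], as [b_k] is small and higher powers of it
    are negligible ([block_part]).  Earlier blocks are crushed by [T^n_k]
    ([past_part]), and later bumps are so small that [T^n_k] cannot enlarge
    them ([tail_part]).  So every nonzero polynomial without constant term in
    the generators has a dense orbit ([generic_orbit]).  Freeness comes for
    free, as 0 has no dense orbit, and the generators are dense since [G_i] is
    within [2^-i] of [y_i]. *)

Local Open Scope classical_set_scope.
Local Open Scope ring_scope.
Local Open Scope complex_scope.

(** * Elementary estimates *)

Section ComplexModulus.
Context (R : realType).
Notation C := R[i].

Lemma normc_real (r : R) : normc (r%:C : C) = `|r|.
Proof. by rewrite /= expr0n addr0 sqrtr_sqr. Qed.

Lemma normcX (z : C) n : normc (z ^+ n) = normc z ^+ n.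
Proof. by apply: complexI; rewrite rmorphXn/= !normc_norm normrX. Qed.

Lemma normc_sum (I : Type) (r : seq I) (F : I -> C) :
  normc (\sum_(i <- r) F i) <= \sum_(i <- r) normc (F i).
Proof.
elim/big_ind2: _ => [|x1 x2 y1 y2 h1 h2|//]; first by rewrite normc0.
by apply: le_trans (le_normcD _ _) _; exact: lerD.
Qed.

Lemma normc_prod (I : Type) (r : seq I) (F : I -> C) :
  normc (\prod_(i <- r) F i) = \prod_(i <- r) normc (F i).
Proof.
elim/big_ind2: _ => [|x1 x2 y1 y2 h1 h2|//]; first by rewrite normc1.
by rewrite normcM h1 h2.
Qed.

End ComplexModulus.

Lemma ler_sum_subset (R : realType) (T : eqType) (r t : seq T) (a : T -> R) :
  (forall x, 0 <= a x) -> uniq r -> {subset r <= t} ->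
  \sum_(x <- r) a x <= \sum_(x <- t) a x.
Proof.
move=> a0; elim: r t => [|x r IH] t /=; first by rewrite big_nil sumr_ge0.
move=> /andP[xr ur] rt; have xt : x \in t by rewrite rt ?mem_head.
rewrite big_cons (perm_big _ (perm_to_rem xt)) big_cons lerD2l IH// => y yr.
have yx : y != x by apply: contraNneq xr => <-.
have := rt y; rewrite inE yr orbT => /(_ isT).
by rewrite (perm_mem (perm_to_rem xt)) inE (negbTE yx).
Qed.

Lemma sum_indicator_le1 (R : realType) (T : eqType) (u : T) (A : seq T) : uniq A ->
  \sum_(v <- A) ((v == u)%:R : R) <= 1.
Proof.
move=> uA; rewrite -natr_sum [leRHS](_ : 1 = 1%:R)// ler_nat -big_mkcond/= sum1_count.
by rewrite count_uniq_mem// leq_b1.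
Qed.

Lemma sum_geometric_pickle (R : realType) (V : countType) (A : seq V) : uniq A ->
  \sum_(u <- A) (2^-1 : R) ^+ (choice.pickle u).+1 <= 1.
Proof.
move=> uA; pose N := (\max_(u <- A) (choice.pickle u).+1)%N.
have geo n : \sum_(i < n) (2^-1 : R) ^+ i.+1 = 1 - 2^-1 ^+ n.
  elim: n => [|n IH]; first by rewrite big_ord0 expr0 subrr.
  by rewrite big_ord_recr/= IH exprS; field.
have -> : \sum_(u <- A) (2^-1 : R) ^+ (choice.pickle u).+1 =
    \sum_(i <- map choice.pickle A) (2^-1 : R) ^+ i.+1 by rewrite big_map.
apply: (@le_trans _ _ (\sum_(i <- iota 0 N) (2^-1 : R) ^+ i.+1)).
  apply: ler_sum_subset => [x||x /mapP[u uIA ->]].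
  - by rewrite exprn_ge0// invr_ge0.
  - by rewrite map_inj_uniq//; exact: (pcan_inj choice.pickleK).
  - rewrite mem_iota/= add0n; have := @leq_bigmax_seq _ A xpredT (fun u => (choice.pickle u).+1) u.
    by move=> /(_ uIA isT).
have := geo N; rewrite -(big_mkord xpredT (fun i => (2^-1 : R) ^+ i.+1)).
rewrite /index_iota subn0 => ->.
by rewrite gerBl exprn_ge0// invr_ge0.
Qed.

Lemma half_pow_small (R : realType) (Q a : R) : 0 <= Q -> 0 < a ->
  exists N, forall k, (N <= k)%N -> 2^-1 ^+ k * Q < a.
Proof.
move=> Q0 a0; have Q1 : 0 < Q + 1 by rewrite ltr_wpDl.
have := @cvg_expr R 2^-1; rewrite ger0_norm ?invr_ge0// invf_lt1// ltr1n => /(_ isT).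
move=> /cvgrPdist_lt/(_ (a / (Q + 1)) (divr_gt0 a0 Q1))[N _ hN]; exists N => k Nk.
have := hN k Nk; rewrite /= sub0r normrN ger0_norm ?exprn_ge0 ?invr_ge0//.
rewrite ltr_pdivlMr//; apply: le_lt_trans.
by rewrite ler_wpM2l ?exprn_ge0 ?invr_ge0// lerDl.
Qed.

Lemma four_pow_large (R : realType) (B : R) :
  exists N, forall n, (N <= n)%N -> B <= 4 ^+ n.
Proof.
exists (Num.truncn B).+1 => n Nn.
have nB : B <= n%:R.
  by apply: le_trans (ltW (truncnS_gt B)) _; rewrite ler_nat.
apply: le_trans nB _; rewrite -natrX ler_nat; apply: ltnW.
exact: ltn_expl.
Qed.

(** Enumerate the pairs of an element and a natural number, and forget the
    number. *)
Lemma infinitely_often (A : countType) (a0 : A) : exists e : nat -> A,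
  forall a N, exists2 k, (N <= k)%N & e k = a.
Proof.
pose unp k : option (A * nat) := choice.unpickle k.
exists (fun k => if unp k is Some p then p.1 else a0) => a N.
apply: contrapT => h.
have small j : (choice.pickle (a, j : nat) < N)%N.
  rewrite ltnNge; apply/negP => Nj; apply: h.
  by exists (choice.pickle (a, j : nat)) => //; rewrite /unp choice.pickleK.
have := @uniq_leq_size _ [seq choice.pickle (a, j) | j <- iota 0 N.+1] (iota 0 N).
rewrite size_map !size_iota ltnn => /(_ _ _)/wrap[]//.
  rewrite map_inj_uniq ?iota_uniq// => i j /(pcan_inj choice.pickleK).
  by case.
by move=> _ /mapP[j _ ->]; rewrite mem_iota add0n small.
Qed.

(** * Estimates valid in all the sequence spaces *)

Section SpaceLemmas.
Context (R : realType) (V : countType).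
Implicit Types (f g : V -> R[i]) (s : space_kind R).

Lemma esum_le_seq (a : V -> R) (C : \bar R) :
  (forall A : seq V, uniq A -> ((\sum_(v <- A) a v)%:E <= C)%E) ->
  (\esum_(v in [set: V]) (a v)%:E <= C)%E.
Proof.
move=> aC; apply: ge_ereal_sup => _ [F [finF _] <-].
rewrite fsbig_finite//= sumEFin; apply: aC; exact: fset_uniq.
Qed.

Lemma seq_le_esum (a : V -> R) (A : seq V) : uniq A ->
  ((\sum_(v <- A) a v)%:E <= \esum_(v in [set: V]) (a v)%:E)%E.
Proof.
move=> uA; apply: esum_ge; exists [set` A]; first by split => //; exact: finite_seq.
by rewrite -fsbig_seq// sumEFin.
Qed.

Lemma space_norm_ge s f v : space_set s f -> normc (f v) <= space_norm s f.
Proof. by case: s => [p p1|] /=; [exact: le_lp_norm|exact: sup_norm_ge]. Qed.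

(** Pulling back along an injection keeps all the norms under control.  The shift
    is bounded this way: each of its values is dominated by the value at a
    single well-chosen child, and distinct vertices have distinct children. *)
Lemma space_dominated s f g (phi : V -> V) (C : R) : injective phi -> 0 <= C ->
  (forall v, normc (g v) <= C * normc (f (phi v))) -> space_set s f ->
  space_set s g /\ space_norm s g <= C * space_norm s f.
Proof.
move=> phiI C0 gf; case: s => [p p1|] /= fs.
  have p0 : 0 < p by exact: lt_le_trans p1.
  have H : (lp_sum p g <= ((C * lp_norm p f) `^ p)%:E)%E.
    rewrite powRM ?lp_norm_ge0// EFinM lp_normK//.
    apply: (@le_trans _ _ (\esum_(v in [set: V]) (C `^ p * normc (f (phi v)) `^ p)%:E)%E).
      apply: le_esum => v _; rewrite lee_fin -powRM ?normc_ge0//.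
      by rewrite ge0_ler_powR ?nnegrE ?mulr_ge0 ?normc_ge0// ltW.
    apply: le_trans (ge0_le_esumZ (powR_ge0 _ _) _) _ => [v|]; first exact: powR_ge0.
    apply: lee_wpmul2l; first by rewrite lee_fin powR_ge0.
    apply: esum_le_seq => A uA.
    have -> : \sum_(v <- A) normc (f (phi v)) `^ p =
              \sum_(v <- map phi A) normc (f v) `^ p by rewrite big_map.
    have := @seq_le_esum (fun v => normc (f v) `^ p) (map phi A).
    by rewrite map_inj_uniq// => /(_ uA).
  split; first exact: le_lt_trans H (ltry _).
  by apply: lp_norm_le => //; rewrite mulr_ge0 ?lp_norm_ge0.
split=> [e e0|].
  have C10 : 0 < C + 1 by rewrite ltr_wpDl.
  have [F finF fF] := fs (e / (C + 1)) (divr_gt0 e0 C10).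
  exists (phi @^-1` F); first by apply: finite_preimage => // x y _ _; exact: phiI.
  move=> v Fv; apply: le_lt_trans (gf v) _.
  have := fF _ Fv; rewrite ltr_pdivlMr// => /(le_lt_trans _); apply.
  by rewrite mulrC ler_wpM2l ?normc_ge0// lerDl.
apply: sup_norm_le => [|v]; first by rewrite mulr_ge0 ?sup_norm_ge0.
by apply: le_trans (gf v) _; rewrite ler_wpM2l ?sup_norm_ge.
Qed.

(** The l^1 norm dominates all the norms.  The vectors constructed below are
    absolutely summable, so that one estimate serves every space. *)
Lemma l1_space s f (C : R) : 0 <= C ->
  (forall A : seq V, uniq A -> \sum_(v <- A) normc (f v) <= C) ->
  space_set s f /\ space_norm s f <= C.
Proof.
move=> C0 fC.
have f1 v : normc (f v) <= C by have := fC [:: v] isT; rewrite big_seq1.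
case: s => [p p1|] /=.
  have p0 : 0 < p by exact: lt_le_trans p1.
  have H : (lp_sum p f <= (C `^ p)%:E)%E.
    apply: esum_le_seq => A uA; rewrite lee_fin.
    apply: (@le_trans _ _ (\sum_(v <- A) normc (f v) * C `^ (p - 1))).
      apply: ler_sum => v _; rewrite -mulr_powRB1 ?normc_ge0//.
      rewrite ler_wpM2l ?normc_ge0// ge0_ler_powR ?nnegrE ?normc_ge0//.
      by rewrite subr_ge0.
    by rewrite -mulr_suml -(mulr_powRB1 C0 p0) ler_wpM2r ?powR_ge0// fC.
  split; first exact: le_lt_trans H (ltry _).
  exact: lp_norm_le.
split=> [e e0|]; last exact: sup_norm_le.
exists [set v | e <= normc (f v)]; last first.
  by move=> v /negP; rewrite -ltNge.
apply: contrapT => /(infinite_set_fset (Num.truncn (C / e)).+1)[B BA nB].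
have := fC B (fset_uniq B); apply/negP; rewrite -ltNge.
apply: (@lt_le_trans _ _ (\sum_(v <- B) e)).
  rewrite big_const_seq count_predT iter_addr addr0 -mulr_natr mulrC.
  rewrite -ltr_pdivrMr//; apply: lt_le_trans (truncnS_gt _) _.
  by rewrite ler_nat.
rewrite big_seq [leRHS]big_seq; apply: ler_sum => v vB.
exact: (BA v vB).
Qed.

Lemma space_trunc s f (e : R) : space_set s f -> 0 < e ->
  exists A : seq V, space_norm s (fun v => if v \in A then 0 else f v) < e.
Proof.
case: s => [p p1|] /= fs e0.
  have p0 : 0 < p by exact: lt_le_trans p1.
  have e20 : 0 < e / 2 by rewrite divr_gt0.
  have d0 : 0 < (e / 2) `^ p by rewrite powR_gt0.
  have : ((lp_sum p f - ((e / 2) `^ p)%:E) < lp_sum p f)%E.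
    by rewrite lp_sum_fineK// -EFinB lte_fin ltrBlDr ltrDl.
  move=> /ereal_sup_gt[_ [F [finF _] <-]].
  rewrite fsbig_finite//= sumEFin => hF.
  exists (fset_set F).
  set g := fun v => _.
  suff : lp_norm p g <= e / 2 by move=> /le_lt_trans; apply; rewrite ltr_pdivrMr// ltr_pMr// ltr1n.
  apply: lp_norm_le => //; first exact: ltW.
  apply: esum_le_seq => A uA; rewrite lee_fin.
  have := @seq_le_esum (fun v => normc (f v) `^ p) (fset_set F ++ [seq v <- A | v \notin fset_set F]).
  rewrite cat_uniq fset_uniq filter_uniq//= andbT => /(_ _)/wrap[].
    by apply/hasPn => x; rewrite mem_filter => /andP[].
  rewrite big_cat/= big_filter -/(lp_sum p f) => H.
  move: hF; rewrite lp_sum_fineK// in H *; rewrite -EFinB lte_fin => hF.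
  move: H; rewrite lee_fin => H.
  have -> : \sum_(v <- A) normc (g v) `^ p =
            \sum_(i <- A | i \notin fset_set F) normc (f i) `^ p.
    rewrite [RHS]big_mkcond/=; apply: eq_bigr => v _; rewrite /g.
    by case: ifP => // _; rewrite normc0 powR0// gt_eqF.
  lra.
have e20 : 0 < e / 2 by rewrite divr_gt0.
have [F finF fF] := fs _ e20.
exists (fset_set F).
set g := fun v => _.
suff : sup_norm g <= e / 2 by move=> /le_lt_trans; apply; rewrite ltr_pdivrMr// ltr_pMr// ltr1n.
apply: sup_norm_le; first exact: ltW.
move=> v; rewrite /g in_fset_set//; case: ifPn => [_|/negP]; first by rewrite normc0 ltW.
by move=> vF; apply/ltW/fF => Fv; apply: vF; exact: mem_set.
Qed.

End SpaceLemmas.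

(** * Unordered sums of complex numbers *)

Section UnorderedSums.
Context (R : realType) (V : countType).
Implicit Types (a b : V -> R[i]) (l m : R[i]).

(** Convergence along the finite sets of indices, with real tolerances; see
    [has_sum_cvg] for the filter form. *)
Definition has_sum a l := forall e : R, 0 < e -> exists A0 : {fset V},
  forall A : {fset V}, fsubset A0 A -> normc (\sum_(v <- A) a v - l) < e.

Lemma has_sum_lin a b l m (z : R[i]) : has_sum a l -> has_sum b m ->
  has_sum (fun v => z * a v + b v) (z * l + m).
Proof.
move=> al bm e e0.
have z0 : 0 < normc z + 1 by rewrite ltr_wpDl ?normc_ge0.
have [A0 hA] := al (e / 2 / (normc z + 1)) ltac:(by rewrite !divr_gt0).
have [B0 hB] := bm (e / 2) ltac:(by rewrite divr_gt0).
exists (A0 `|` B0)%fset => A; rewrite fsubUset => /andP[/hA + /hB].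
rewrite ltr_pdivlMr// => h1 h2.
rewrite big_split/= -mulr_sumr.
have -> : z * \sum_(v <- A) a v + \sum_(v <- A) b v - (z * l + m) =
  z * (\sum_(v <- A) a v - l) + (\sum_(v <- A) b v - m) by ring.
apply: le_lt_trans (le_normcD _ _) _; rewrite normcM.
have := normc_ge0 (\sum_(v <- A) a v - l); move: h1 h2.
set x := normc (_ - l); set y := normc (_ - m) => h1 h2 x0.
have : normc z * x <= x * (normc z + 1) by rewrite mulrC ler_wpM2l// lerDl.
lra.
Qed.

Lemma has_sum_unique a l m : has_sum a l -> has_sum a m -> l = m.
Proof.
move=> al am; apply/eqP; rewrite -subr_eq0; apply/eqP/eq0_normc/eqP.
rewrite eq_le normc_ge0 andbT leNgt; apply/negP => lm.
have [A0 hA] := al (normc (l - m) / 2) ltac:(by rewrite divr_gt0).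
have [B0 hB] := am (normc (l - m) / 2) ltac:(by rewrite divr_gt0).
have h1 := hA (A0 `|` B0)%fset (fsubsetUl _ _).
have h2 := hB (A0 `|` B0)%fset (fsubsetUr _ _).
have : normc (l - m) < normc (l - m); last by rewrite ltxx.
set S := \sum_(v <- _) _ in h1 h2.
have {1}-> : l - m = - (S - l) + (S - m) by ring.
apply: le_lt_trans (le_normcD _ _) _; rewrite normcN; lra.
Qed.

Lemma has_sum_le a l (C : R) :
  (forall A : seq V, uniq A -> \sum_(v <- A) normc (a v) <= C) ->
  has_sum a l -> normc l <= C.
Proof.
move=> aC al; rewrite leNgt; apply/negP => Cl.
have [A0 hA] := al (normc l - C) ltac:(by rewrite subr_gt0).
have := hA A0 (fsubset_refl _); apply/negP; rewrite -leNgt.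
have := aC A0 (fset_uniq _).
have := normc_sum A0 a; move: (\sum_(v <- A0) a v) => S.
have : normc l <= normc S + normc (S - l).
  have -> : normc l = normc (S + - (S - l)) by congr normc; ring.
  by apply: le_trans (le_normcD _ _) _; rewrite normcN.
lra.
Qed.

Lemma has_sum_fset a (A : {fset V}) : (forall v, v \notin A -> a v = 0) ->
  has_sum a (\sum_(v <- A) a v).
Proof.
move=> a0 e e0; exists A => B AB.
rewrite (big_fsetID _ (mem A))/= [X in _ + X - _]big1_fset ?addr0; last first.
  by move=> i; rewrite !inE/= => /andP[_ /a0].
rewrite (_ : [fset _ | _ in _ & _]%fset = A) ?subrr ?normc0//.
apply/fsetP => v; rewrite !inE/= andbC; case: (boolP (v \in A)) => //= vA.
exact: (fsubsetP AB).
Qed.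

(** The sum is the supremum of the finite partial sums. *)
Lemma has_sum_real_ge0 (r : V -> R) (C : R) : (forall v, 0 <= r v) ->
  (forall A : seq V, uniq A -> \sum_(v <- A) r v <= C) ->
  exists l, has_sum (fun v => (r v)%:C) l.
Proof.
move=> r0 rC.
pose S := [set x | exists A : {fset V}, x = \sum_(v <- A) r v].
have supS : has_sup S.
  split; first by exists 0; exists fset0; rewrite big_seq_fset0.
  by exists C => _ [A ->]; apply: rC; exact: fset_uniq.
exists (sup S)%:C => e e0.
have [_ [A0 ->] hA0] := sup_adherent e0 supS.
exists A0 => A A0A.
have hA : \sum_(v <- A) r v <= sup S by apply: sup_ubound => //; [exact: supS.2|exists A].
have h : \sum_(v <- A0) r v <= \sum_(v <- A) r v.
  rewrite [leRHS](big_fsetID _ (mem A0))/=.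
  rewrite (_ : [fset _ | _ in _ & _]%fset = A0) ?lerDl ?sumr_ge0//.
  apply/fsetP => v; rewrite !inE/= andbC; case: (boolP (v \in A0)) => //= vA.
  exact: (fsubsetP A0A).
rewrite -rmorph_sum -rmorphB normc_real.
rewrite ltr_norml; apply/andP; split; lra.
Qed.

(** Real and imaginary parts are differences of the nonnegative families
    [|r| + r] and [|r|], to which the supremum argument applies. *)
Lemma has_sum_exists a (C : R) :
  (forall A : seq V, uniq A -> \sum_(v <- A) normc (a v) <= C) ->
  exists l, has_sum a l.
Proof.
move=> aC.
have key (r : V -> R) : (forall v, `|r v| <= normc (a v)) ->
    exists l, has_sum (fun v => (r v)%:C) l.
  move=> ra.
  have [l1 h1] : exists l, has_sum (fun v => (`|r v|)%:C) l.
    apply: (@has_sum_real_ge0 _ C) => // A uA; apply: le_trans (aC A uA).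
    by apply: ler_sum => v _; exact: ra.
  have [l2 h2] : exists l, has_sum (fun v => (`|r v| + r v)%:C) l.
    apply: (@has_sum_real_ge0 _ (C + C)) => [v|A uA].
      by have := ler_norm (- r v); rewrite normrN; lra.
    apply: le_trans (lerD (aC A uA) (aC A uA)).
    rewrite -big_split/=; apply: ler_sum => v _.
    by rewrite lerD// (le_trans (ler_norm _)).
  exists (-1 * l1 + l2); have := has_sum_lin (-1) h1 h2.
  by congr has_sum; apply/funext => v; rewrite rmorphD/= mulN1r addKr.
have [lr hr] : exists l, has_sum (fun v => (complex.Re (a v))%:C) l.
  by apply: key => v; rewrite -lecR normc_norm; exact: normc_ge_Re.
have [li hi] : exists l, has_sum (fun v => (complex.Im (a v))%:C) l.
  by apply: key => v; case: (a v) => x y /=; rewrite -sqrtr_sqr ler_wsqrtr// lerDr sqr_ge0.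
exists ('i * li + lr); have := has_sum_lin 'i hi hr.
by congr has_sum; apply/funext => v; rewrite [RHS]complexE addrC.
Qed.

Lemma has_sum_cvg a l : has_sum a l ->
  summability.partial_sum (fun v => a v : R[i]^o) @ summability.totally
    --> (l : R[i]^o).
Proof.
move=> al.
apply/(@cvgrPdist_lt _ _ _ _ (summability.totally_filter)) => e e0.
have er : e = (complex.Re e)%:C by rewrite RRe_real// gtr0_real.
have [A0 hA] := al (complex.Re e) ltac:(by rewrite -ltcR -er).
exists A0 => // A /= /hA h; rewrite distrC er.
have -> : summability.partial_sum (fun v => a v : R[i]^o) A = \sum_(v <- A) a v.
  by rewrite /summability.partial_sum big_seq_fsetE.
by rewrite -[ltLHS]normc_norm ltcR.
Qed.

End UnorderedSums.

(** * Norms, point masses and truncations *)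

Section TreeSpaceTheory.
Context (R : realType) (V : countType) (s : space_kind R).
Notation X := (tree_space V s).
Implicit Types (f g : X) (u v : V) (z : R[i]).

(** The norm of [X] takes its values in the complex numbers; estimates are carried
    out on this real version. *)
Definition nrm f : R := space_norm s f.

Lemma nrmE f : `|f| = (nrm f)%:C. Proof. by []. Qed.

Lemma nrm_ge0 f : 0 <= nrm f.
Proof. exact/space_norm_ge0/space_fun_set. Qed.

Lemma nrmD f g : nrm (f + g) <= nrm f + nrm g.
Proof. by rewrite -lecR rmorphD/= -!nrmE ler_normD. Qed.

Lemma nrmZ z f : nrm (z *: f) = normc z * nrm f.
Proof. by apply: complexI; rewrite rmorphM/= -nrmE normrZ. Qed.

Lemma nrmN f : nrm (- f) = nrm f.
Proof. by apply: complexI; rewrite -!nrmE normrN. Qed.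

Lemma nrm0 : nrm 0 = 0.
Proof. by apply: complexI; rewrite -!nrmE normr0. Qed.

Lemma nrmB f g : nrm (f - g) <= nrm f + nrm g.
Proof. by rewrite -(nrmN g) nrmD. Qed.

Lemma nrm_sum (I : Type) (r : seq I) (F : I -> X) :
  nrm (\sum_(i <- r) F i) <= \sum_(i <- r) nrm (F i).
Proof.
elim/big_ind2: _ => [|x1 x2 y1 y2 h1 h2|//]; first by rewrite nrm0.
by apply: le_trans (nrmD _ _) _; exact: lerD.
Qed.

Lemma coord_le_nrm f v : normc (f v) <= nrm f.
Proof. exact/space_norm_ge/space_fun_set. Qed.

Lemma open_nrm (O : set X) g : open O -> O g ->
  exists2 r : R, 0 < r & forall f, nrm (f - g) < r -> O f.
Proof.
move=> oO Og; have /nbhs_normP[e /= e0 eO] : nbhs g O by exact: open_nbhs_nbhs.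
have er : e = (complex.Re e)%:C by rewrite RRe_real// gtr0_real.
exists (complex.Re e); first by rewrite -ltcR -er.
by move=> f fg; apply: eO => /=; rewrite distrC nrmE er ltcR.
Qed.

Lemma nrm_ball_open g (r : R) : open [set f | nrm (f - g) < r].
Proof.
have -> : [set f | nrm (f - g) < r] = ball g r%:C.
  apply/seteqP; split=> f /=; rewrite -ball_normE/= distrC nrmE ltcR//.
exact: ball_open.
Qed.

Lemma coordD f g v : (f + g) v = f v + g v. Proof. by []. Qed.
Lemma coordB f g v : (f - g) v = f v - g v. Proof. by []. Qed.
Lemma coordZ z f v : (z *: f) v = z * f v. Proof. by []. Qed.
Lemma coord_sum (I : Type) (r : seq I) (F : I -> X) v :
  (\sum_(i <- r) F i) v = \sum_(i <- r) F i v.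
Proof. by elim/big_ind2: _ => // x1 x2 y1 y2 <- <-. Qed.

Lemma space_ext f g : (forall v, f v = g v) -> f = g.
Proof. by move=> fg; apply: val_inj; apply/funext => v; exact: fg. Qed.

Lemma l1_element (a : V -> R[i]) (C : R) : 0 <= C ->
  (forall A : seq V, uniq A -> \sum_(v <- A) normc (a v) <= C) ->
  exists2 f : X, (forall v, f v = a v) & nrm f <= C.
Proof.
move=> C0 aC; have [aX aN] := l1_space s C0 aC.
by exists (TreeSpace (proj2 (space_predP s _) aX)).
Qed.

Let delta_l1 u (A : seq V) : uniq A ->
  \sum_(v <- A) normc ((v == u)%:R : R[i]) <= (1 : R).
Proof.
move=> uA; rewrite (eq_bigr (fun v => (v == u)%:R)); last first.
  by move=> v _; case: (_ == u); rewrite ?normc0 ?normc1.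
exact: sum_indicator_le1.
Qed.

Fact delta_subproof u : (fun v : V => (v == u)%:R : R[i]) \in space_pred s.
Proof.
apply/space_predP.
have [] // := @l1_space R V s (fun v : V => (v == u)%:R : R[i]) 1 ler01.
by move=> A uA; exact: delta_l1.
Qed.
Definition delta u : X := TreeSpace (delta_subproof u).

Lemma coord_delta u v : delta u v = (v == u)%:R. Proof. by []. Qed.

Lemma nrm_delta u : nrm (delta u) <= 1.
Proof.
have [] // := @l1_space R V s (fun v : V => (v == u)%:R : R[i]) 1 ler01.
by move=> A uA; exact: delta_l1.
Qed.

Definition restr (A : seq V) (f : V -> R[i]) : X :=
  \sum_(u <- undup A) f u *: delta u.

Lemma coord_restr A (f : V -> R[i]) v : restr A f v = if v \in A then f v else 0.
Proof.
rewrite coord_sum; under eq_bigr do rewrite coordZ coord_delta.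
have [vA|vA] := boolP (v \in A).
  rewrite (bigD1_seq v) ?mem_undup ?undup_uniq//= eqxx mulr1 big1 ?addr0// => u uv.
  by rewrite eq_sym (negbTE uv) mulr0.
rewrite big_seq big1// => u; rewrite mem_undup => uA.
by case: eqP => [vu|_]; rewrite ?mulr0//; rewrite vu uA in vA.
Qed.

Lemma nrm_restr A (f : V -> R[i]) : nrm (restr A f) <= \sum_(u <- undup A) normc (f u).
Proof.
apply: le_trans (nrm_sum _ _) _; apply: ler_sum => u _.
by rewrite nrmZ ler_piMr ?normc_ge0 ?nrm_delta.
Qed.

Lemma restr_dense g (e : R) : 0 < e -> exists A, nrm (g - restr A g) < e.
Proof.
move=> e0; have [A hA] := space_trunc (space_fun_set g) e0; exists A.
rewrite /nrm (_ : space_fun _ = fun v => if v \in A then 0 else g v)//.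
apply/funext => v; rewrite coordB coord_restr.
by case: ifP => _; rewrite ?subrr ?subr0.
Qed.

End TreeSpaceTheory.

(** * The weighted backward shift as a bounded operator *)

Section ShiftOperator.
Context (R : realType) (V : countType) (E : rel V) (s : space_kind R).
Notation X := (tree_space V s).
Variables (lam : V -> R[i]) (M : V -> R) (C : R).
Hypothesis leafE : leafless E.
Hypothesis parentE : forall a a' b : V, E a b -> E a' b -> a = a'.
Hypothesis lam0 : forall v, lam v != 0.
Hypothesis C0 : 0 < C.
Hypothesis rowM : forall v (A : seq V), uniq A ->
  \sum_(u <- A) (if E v u then normc (lam u) else 0) <= M v.
Hypothesis MC : forall v, M v <= C.

Let term (f : V -> R[i]) v u : R[i] := if E v u then lam u * f u else 0.

Let term_le f v (t : R) : 0 <= t -> (forall u, E v u -> normc (f u) <= t) ->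
  forall A : seq V, uniq A -> \sum_(u <- A) normc (term f v u) <= M v * t.
Proof.
move=> t0 ft A uA; apply: le_trans (ler_wpM2r t0 (rowM v uA)).
rewrite mulr_suml; apply: ler_sum => u _; rewrite /term; case: ifPn => Evu.
  by rewrite normcM ler_wpM2l ?normc_ge0 ?ft.
by rewrite normc0 mul0r.
Qed.

Let B f v : R[i] := xget 0 [set l | has_sum (term f v) l].

Let BP (f : X) v : has_sum (term f v) (B f v).
Proof.
have [|l hl] := @has_sum_exists R V (term f v) (M v * nrm f).
  apply: term_le => [|u _]; [exact: nrm_ge0|exact: coord_le_nrm].
exact: (@xgetI _ _ _ l hl).
Qed.

Let B_le (f : X) v (t : R) : 0 <= t -> (forall u, E v u -> normc (f u) <= t) ->
  normc (B f v) <= M v * t.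
Proof. by move=> t0 ft; apply: has_sum_le (BP f v); exact: term_le. Qed.

(* The supremum over infinitely many children need not be attained; the factor
   2 leaves room for choosing one child. *)
Let B_child (f : X) v : exists u, E v u /\ normc (B f v) <= 2 * C * normc (f u).
Proof.
apply: contrapT => /forallNP nu.
have fu u : E v u -> normc (f u) <= normc (B f v) / (2 * C).
  move=> Evu; rewrite ler_pdivlMr ?mulr_gt0// mulrC leNgt; apply/negP => lt.
  by apply: (nu u); split=> //; exact: ltW.
have t0 : 0 <= normc (B f v) / (2 * C) by rewrite divr_ge0 ?normc_ge0// mulr_ge0// ltW.
have h1 := le_trans (B_le t0 fu) (ler_wpM2r t0 (MC v)).
have B0 : normc (B f v) <= 0.
  move: h1; rewrite (_ : C * _ = normc (B f v) / 2); first lra.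
  by field; rewrite gt_eqF.
have [u Evu] := leafE v; apply: (nu u); split=> //.
by apply: le_trans B0 _; rewrite !mulr_ge0 ?normc_ge0// ltW.
Qed.

Let B_dom (f : X) : space_set s (B f) /\ space_norm s (B f) <= 2 * C * nrm f.
Proof.
have [phi hphi] := choice (B_child f).
apply: (@space_dominated R V s (f : V -> R[i]) _ phi) => [x y xy| |v|].
- by apply: parentE (hphi x).1 _; rewrite xy; exact: (hphi y).1.
- by rewrite mulr_ge0// ltW.
- exact: (hphi v).2.
- exact: space_fun_set.
Qed.

(** Summable rows make the shift well defined; the row bound [M v] gives pointwise
    control at [v], and its uniform bound [C] gives boundedness. *)
Lemma exists_shift : exists T : {linear X -> X},
  [/\ weighted_backward_shift E lam T,
      (forall (f : X) v (t : R), 0 <= t -> (forall u, E v u -> normc (f u) <= t) ->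
         normc (T f v) <= M v * t) &
      (forall f : X, nrm (T f) <= 2 * C * nrm f)].
Proof.
pose T0 (f : X) : X := TreeSpace (proj2 (space_predP s _) (B_dom f).1).
have T0lin : linear T0.
  move=> z f g; apply: space_ext => v; rewrite coordD coordZ.
  apply: (has_sum_unique (BP _ v)).
  have := has_sum_lin z (BP f v) (BP g v); congr has_sum; apply/funext => u.
  rewrite /term; case: ifP => _; rewrite ?coordD ?coordZ ?mulr0 ?addr0//.
  by ring.
pose T : {linear X -> X} := HB.pack T0 (GRing.isLinear.Build _ _ _ _ T0 T0lin).
have TN f : nrm (T f) <= 2 * C * nrm f by exact: (B_dom f).2.
exists T; split; [|exact: B_le|exact: TN].
split=> //; last by move=> f v; exact/has_sum_cvg/BP.
apply/bounded_funP => r; exists ((2 * C)%:C * r) => f fr.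
rewrite nrmE; apply: (@le_trans _ _ ((2 * C)%:C * (nrm f)%:C)).
  by rewrite -rmorphM lecR.
by rewrite ler_wpM2l// lecR mulr_ge0// ltW.
Qed.

End ShiftOperator.

(** * Ancestors, preferred children and weights *)

Section Tree.
Context (V : countType) (E : rel V).
Hypothesis dtE : directed_tree E.
Hypothesis leafE : leafless E.
Implicit Types (u v w : V) (k m n : nat).

Definition parent u : option V :=
  if pselect (exists v, E v u) is left h then Some (xchoose h) else None.

Lemma parP u v : parent u = Some v <-> E v u.
Proof.
rewrite /parent; case: pselect => [h|h]; split=> //.
- by move=> [<-]; exact: (xchooseP h).
- by move=> Evu; congr Some; exact: (dtree_parent_unique dtE (xchooseP h) Evu).
- by move=> Evu; exfalso; apply: h; exists v.
Qed.

(** The result is [None] when the way up ends before [n] steps. *)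
Fixpoint ancestor n u : option V :=
  if n is n'.+1 then (if parent u is Some v then ancestor n' v else None) else Some u.

Lemma ancD m n u : ancestor (m + n) u = if ancestor m u is Some w then ancestor n w else None.
Proof. by elim: m u => //= m IH u; case: (parent u) => [v|]. Qed.

Lemma ancSr n u w : ancestor n u = Some w -> ancestor n.+1 u = parent w.
Proof. by rewrite -addn1 ancD => -> /=; case: (parent w). Qed.

Lemma anc_path n u w : ancestor n u = Some w ->
  exists p, [/\ path E w p, last w p = u & size p = n].
Proof.
elim: n u => [|n IH] u /=; first by move=> [->]; exists [::].
case Pu : (parent u) => [v|//] /IH[p [wp lp sp]]; exists (rcons p u).
by rewrite rcons_path wp lp last_rcons size_rcons sp; split=> //; exact/parP.
Qed.

Lemma anc_acyclic n v : ancestor n.+1 v <> Some v.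
Proof.
move=> /anc_path[p []]; case/lastP: p => [//|p x].
rewrite last_rcons => wp xv _; rewrite xv in wp.
by have := dtree_acyclic dtE (c := v :: p) wp.
Qed.

Lemma anc_inj m n u w : ancestor m u = Some w -> ancestor n u = Some w -> m = n.
Proof.
wlog mn : m n / (m <= n)%N => [H um un|um].
  by have [/H|/ltnW/H nm] := leqP m n; [exact|exact/esym/nm].
rewrite -(subnKC mn) ancD um; case: (n - m)%N => [_|k]; first by rewrite addn0.
by move=> /anc_acyclic.
Qed.

(** Moving one endpoint along an edge keeps a common ancestor: a step down
    lengthens the way up by one, and a step up shortens it by one, unless the
    endpoint was itself the common ancestor, which is then replaced by its
    parent. *)
Lemma common_ancestor u v : exists m n w, ancestor m u = Some w /\ ancestor n v = Some w.
Proof.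
have [p [vp <-]] := dtree_connected dtE v u; elim/last_ind: p vp => [_|p x IH].
  by exists 0%N, 0%N, v.
rewrite rcons_path last_rcons => /andP[/IH[m [n [w [mw nw]]]] /orP[Ex|Ex]].
  by exists m.+1, n, w; split=> //=; move/parP: Ex => ->.
case: m mw => [[wE]|m] /=.
  exists 0%N, n.+1, x; split=> //; rewrite (ancSr nw); apply/parP.
  by rewrite -wE.
by move/parP: Ex => -> mw; exists m, n, w.
Qed.

Variable v0 : V.

Definition on_line u := exists k, ancestor k v0 = Some u.
Definition below u := exists k, ancestor k u = Some v0.

(** On the line above [v0] the child leading to [v0] is determined, because by
    acyclicity a vertex is a [k]-th ancestor of [v0] for only one [k]. *)
Lemma exists_child_choice : exists c : V -> V,
  (forall v, E v (c v)) /\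
  (forall v k, ancestor k.+1 v0 = Some v -> ancestor k v0 = Some (c v)).
Proof.
suff : forall v, exists u, E v u /\
    forall k, ancestor k.+1 v0 = Some v -> ancestor k v0 = Some u.
  by move=> /choice[c hc]; exists c; split=> v; have [] := hc v.
move=> v; have [[k hk]|nk] := pselect (exists k, ancestor k.+1 v0 = Some v).
  move: (hk); rewrite -addn1 ancD; case Ek : (ancestor k v0) => [u|//] /=.
  case Pu : (parent u) => [w|//] [wv]; exists u; split; first by apply/parP; rewrite -wv.
  by move=> j hj; have [<-] := @anc_inj k.+1 j.+1 v0 v hk hj.
by have [u Evu] := leafE v; exists u; split=> // k hk; exfalso; apply: nk; exists k.
Qed.

(** Depth below [v0], with the junk value 0 outside the subtree of [v0]; this is
    what makes the weight on preferred children equal to 4 there. *)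
Lemma exists_depth : exists dep : V -> nat,
  (forall v k, ancestor k v = Some v0 -> dep v = k) /\ (forall v, ~ below v -> dep v = 0%N).
Proof.
suff : forall v, exists j, (forall k, ancestor k v = Some v0 -> j = k) /\
    (~ below v -> j = 0%N).
  by move=> /choice[c hc]; exists c; split=> v; have [] := hc v.
move=> v; have [[k hk]|nk] := pselect (below v).
  exists k; split; first by move=> j; exact: anc_inj.
  by move=> []; exists k.
by exists 0%N; split=> // k hk; exfalso; apply: nk; exists k.
Qed.

Variables (c : V -> V) (dep : V -> nat).
Hypothesis cE : forall v, E v (c v).
Hypothesis cline : forall v k, ancestor k.+1 v0 = Some v -> ancestor k v0 = Some (c v).
Hypothesis dep_below : forall v k, ancestor k v = Some v0 -> dep v = k.
Hypothesis dep_out : forall v, ~ below v -> dep v = 0%N.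

Lemma par_c v : parent (c v) = Some v. Proof. exact/parP. Qed.

Lemma anc_iter_c n v : ancestor n (iter n c v) = Some v.
Proof. by elim: n => //= n IH; rewrite par_c. Qed.

Lemma on_line_par u v : on_line u -> parent u = Some v -> exists k, ancestor k.+1 v0 = Some v.
Proof. by move=> [k hk] uv; exists k; rewrite (ancSr hk). Qed.

Lemma strict_not_below v k : ancestor k.+1 v0 = Some v -> ~ below v.
Proof.
move=> hk [j hj]; apply: (@anc_acyclic (k + j) v0).
by rewrite -addSn ancD hk.
Qed.

Lemma on_line_c u v : on_line u -> parent u = Some v -> u = c v.
Proof.
move=> [k hk] uv; have := @cline v k; rewrite (ancSr hk) => /(_ uv).
by rewrite hk => -[].
Qed.

Lemma dep_child_below u v : below v -> parent u = Some v -> dep u = (dep v).+1.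
Proof.
move=> [k hk] uv; rewrite (dep_below hk); apply: dep_below.
by rewrite /= uv.
Qed.

Lemma dep_c v : (dep (c v) <= (dep v).+1)%N.
Proof.
have [bv|nb] := pselect (below (c v)); last by rewrite (dep_out nb).
case: bv => -[|k] hk; first by rewrite (dep_below hk).
rewrite (dep_below hk); move: hk; rewrite /= par_c => hk.
by rewrite (dep_below hk).
Qed.

Lemma dep_iter_c n v : (dep (iter n c v) <= dep v + n)%N.
Proof.
elim: n => [|n IH]; first by rewrite addn0.
by rewrite iterS (leq_trans (dep_c _))// addnS ltnS.
Qed.

Lemma iter_c_line v k : ancestor k v0 = Some v -> iter k c v = v0.
Proof.
elim: k v => [|k IH] v; first by move=> [].
by move=> /cline /IH; rewrite iterSr.
Qed.

Section Weights.
Context (R : realType) (d : nat -> R).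
Hypothesis d1 : forall n, 1 <= d n.
Hypothesis dmono : forall m n, (m <= n)%N -> d m <= d n.

Let d0 n : 0 < d n. Proof. exact: lt_le_trans (d1 n). Qed.

(** The factor 1/2 makes paths die on the line above [v0]; the quotient of [d]
    telescopes along branches; the powers of 1/2 make infinite rows summable. *)
Definition vertex_wt u : R :=
  if pselect (on_line u) then 2^-1 else
  if parent u is Some v then
    4 * d (dep v) / d (dep u) * (if u == c v then 1 else 2^-1 ^+ (choice.pickle u).+1)
  else 2^-1.

Lemma vertex_wt_gt0 u : 0 < vertex_wt u.
Proof.
rewrite /vertex_wt; case: pselect => /= _; first by rewrite invr_gt0.
case: (parent u) => [v|]; last by rewrite invr_gt0.
by rewrite mulr_gt0 ?divr_gt0 ?mulr_gt0//; case: ifP => _; rewrite ?exprn_gt0 ?invr_gt0.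
Qed.

(** Inside the subtree of [v0] the bound keeps the quotient of [d], since that is
    what limits the growth at [v0] in the absence of mixing. *)
Definition row_bound v : R := 8 * (if pselect (below v) then d (dep v) / d (dep v).+1 else 1).

Lemma row_bound_le v : row_bound v <= 8.
Proof.
rewrite /row_bound; case: pselect => /= _; last by rewrite mulr1.
by rewrite ler_piMr// ler_pdivrMr// mul1r dmono.
Qed.

Lemma vertex_wt_row v (A : seq V) : uniq A ->
  \sum_(u <- A) (if E v u then vertex_wt u else 0) <= row_bound v.
Proof.
move=> uA; pose K := row_bound v / 2.
have K0 : 0 <= K.
  by rewrite /K /row_bound; case: pselect => /= _; rewrite divr_ge0 ?mulr_ge0 ?invr_ge0// ltW.
apply: (@le_trans _ _ (\sum_(u <- A) K * ((u == c v)%:R + 2^-1 ^+ (choice.pickle u).+1))).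
  apply: ler_sum => u _.
  have p0 : 0 <= 2^-1 ^+ (choice.pickle u).+1 :> R by rewrite exprn_ge0// invr_ge0.
  case: ifPn => [/parP uv|_]; last by rewrite mulr_ge0// addr_ge0.
  rewrite /vertex_wt; case: pselect => /= [lu|nu].
    have nb : ~ below v by have [k /strict_not_below] := on_line_par lu uv.
    have -> : K = 4 by rewrite /K /row_bound; case: pselect => //= _; field.
    rewrite -(on_line_c lu uv) eqxx mulr1n.
    move: p0; move: (_ ^+ _) => x; lra.
  rewrite uv; apply: ler_pM.
  - by rewrite divr_ge0 ?mulr_ge0// ltW.
  - by case: ifP.
  - rewrite /K /row_bound; case: pselect => /= [bv|nb].
      by rewrite (dep_child_below bv uv) le_eqVlt; apply/orP; left; apply/eqP; field; rewrite gt_eqF.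
    rewrite (dep_out nb) mulr1 -mulrA (_ : 8 / 2 = 4 * 1); last by field.
    by rewrite ler_wpM2l// ler_pdivrMr// mul1r dmono.
  - by case: ifP => _; rewrite ?lerDl ?lerDr.
rewrite -mulr_sumr big_split/= (_ : row_bound v = K * (1 + 1)); last by rewrite /K; field.
by rewrite ler_wpM2l// lerD ?sum_geometric_pickle// sum_indicator_le1.
Qed.

(** The value is 0 when there is no [n]-th ancestor, as the point mass is then
    mapped to 0. *)
Fixpoint path_wt n u : R :=
  if n is n'.+1 then (if parent u is Some v then vertex_wt u * path_wt n' v else 0) else 1.

Lemma path_wt_ge0 n u : 0 <= path_wt n u.
Proof.
by elim: n u => //= n IH u; case: (parent u) => // v; rewrite mulr_ge0// ltW// vertex_wt_gt0.
Qed.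

Lemma path_wt_gt0 n u w : ancestor n u = Some w -> 0 < path_wt n u.
Proof.
elim: n u => //= n IH u; case: (parent u) => // v /IH o0.
by rewrite mulr_gt0// vertex_wt_gt0.
Qed.

Lemma path_wtD m n u w : ancestor m u = Some w -> path_wt (m + n) u = path_wt m u * path_wt n w.
Proof.
elim: m u => [|m IH] u /=; first by move=> [->]; rewrite mul1r.
by case: (parent u) => // v /IH ->; rewrite mulrA.
Qed.

Lemma path_wt_line n w : on_line w -> path_wt n w <= 2^-1 ^+ n.
Proof.
elim: n w => //= n IH w lw; case Pw : (parent w) => [v|]; last first.
  by rewrite exprn_ge0// invr_ge0.
rewrite exprS ler_pM ?path_wt_ge0 ?(ltW (vertex_wt_gt0 _))//.
  by rewrite /vertex_wt; case: pselect.
by apply: IH; have [k hk] := on_line_par lw Pw; exists k.+1.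
Qed.

(** From the point where the way up meets the line above [v0], each further step
    contributes a factor 1/2. *)
Lemma path_wt_to0 u (e : R) : 0 < e -> exists N, forall n, (N <= n)%N -> path_wt n u <= e.
Proof.
move=> e0; have [m [j [w [um vw]]]] := common_ancestor u v0.
have [N hN] : exists N, forall n, (N <= n)%N -> path_wt m u * 2^-1 ^+ n <= e.
  have o0 := path_wt_gt0 um.
  have := @cvg_expr R 2^-1; rewrite ger0_norm ?invr_ge0// invf_lt1// ltr1n => /(_ isT).
  move=> /cvgrPdist_lt/(_ (e / path_wt m u) (divr_gt0 e0 o0))[N _ hN]; exists N => n Nn.
  have := hN n Nn; rewrite /= sub0r normrN ger0_norm ?exprn_ge0 ?invr_ge0//.
  by rewrite ltr_pdivlMr// mulrC => /ltW.
exists (m + N)%N => n mNn; have mn : (m <= n)%N by exact: leq_trans (leq_addr _ _) mNn.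
rewrite -(subnKC mn) (path_wtD _ um); apply: le_trans (hN (n - m)%N _).
  by rewrite ler_wpM2l ?path_wt_ge0// path_wt_line//; exists j.
by rewrite leq_subRL.
Qed.

(** Away from the strict ancestors of [v0] the weights along preferred children
    telescope, and depth grows by at most one at each step. *)
Lemma path_wt_branch_off v : (forall k, ancestor k.+1 v0 <> Some v) ->
  forall n, 4 ^+ n / d (dep v + n) <= path_wt n (iter n c v).
Proof.
move=> nv n.
have main : path_wt n (iter n c v) = 4 ^+ n * d (dep v) / d (dep (iter n c v)) /\
    (forall k, ancestor k.+1 v0 <> Some (iter n c v)).
  elim: n => [|n [IH nl]] /=; first by rewrite expr0 mul1r divff// gt_eqF.
  set w := iter n c v in IH nl *.
  have ncl : ~ on_line (c w).
    by move=> /on_line_par/(_ (par_c w))[k]; exact: nl.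
  split; last by move=> k hk; apply: ncl; exists k.+1.
  rewrite par_c IH /vertex_wt; case: pselect => //= _; rewrite par_c eqxx mulr1 exprS.
  by field; rewrite !gt_eqF.
rewrite main.1; apply: (@le_trans _ _ (4 ^+ n / d (dep (iter n c v)))).
  by rewrite ler_wpM2l ?exprn_ge0// lef_pV2 ?posrE ?d0// dmono// dep_iter_c.
by rewrite ler_wpM2r ?invr_ge0 ?(ltW (d0 _))// ler_peMr ?exprn_ge0.
Qed.

(** A branch starting at a strict ancestor of [v0] passes through [v0], so it
    differs from the preceding case by a positive constant factor. *)
Lemma path_wt_branch v : exists (C : R) (K N : nat), 0 < C /\
  forall n, (N <= n)%N -> C * 4 ^+ n / d (K + n) <= path_wt n (iter n c v).
Proof.
have [[k hk]|nv] := pselect (exists k, ancestor k.+1 v0 = Some v); last first.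
  exists 1, (dep v), 0%N; split=> // n _; rewrite mul1r; apply: path_wt_branch_off => k hk.
  by apply: nv; exists k.
have o0 := path_wt_gt0 hk.
exists (path_wt k.+1 v0 / 4 ^+ k.+1), 0%N, k.+1; split=> [|n kn].
  by rewrite divr_gt0// exprn_gt0.
rewrite -{3 4}(subnK kn) iterD (iter_c_line hk).
rewrite (path_wtD _ (anc_iter_c _ _)) mulrC.
have := @path_wt_branch_off v0 (fun k => @anc_acyclic k v0) (n - k.+1).
rewrite (@dep_below v0 0%N erefl) add0n => h.
apply: le_trans (ler_wpM2r (ltW o0) h).
have -> : 4 ^+ n = 4 ^+ (n - k.+1) * 4 ^+ k.+1 :> R by rewrite -exprD subnK.
have -> : path_wt k.+1 v0 / 4 ^+ k.+1 * (4 ^+ (n - k.+1) * 4 ^+ k.+1) =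
          4 ^+ (n - k.+1) * path_wt k.+1 v0.
  by field; rewrite expf_neq0.
rewrite mulrC mulrAC ler_wpM2r ?(ltW o0)// ler_wpM2l ?exprn_ge0//.
by rewrite lef_pV2 ?posrE ?d0// dmono// add0n leq_subr.
Qed.

End Weights.
End Tree.

(** * Polynomials near zero *)

Section Polynomials.
Context (R : realType).
Notation C := R[i].

(** Turns the absence of a constant term into a condition that is visibly stable
    under the operations of an algebra. *)
Lemma meval_at0 d (P : mpoly.mpoly d C) :
  mpoly.meval (fun=> 0) P = mpoly.mcoeff mpoly.mnm0 P.
Proof.
rewrite mpoly.mevalE.
have E (m : mpoly.multinom d) : \prod_(i < d) (0 : C) ^+ m i = (m == mpoly.mnm0)%:R.
  have [->|m0] := eqVneq m mpoly.mnm0.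
    by rewrite big1// => i _; rewrite mpoly.mnm0E expr0.
  have [i mi] : exists i, m i != 0%N.
    apply/existsP; apply: contraNT m0; rewrite negb_exists => /forallP m0.
    by apply/eqP/mpoly.mnmP => i; rewrite mpoly.mnm0E; apply/eqP; rewrite -[_ == _]negbK.
  by rewrite (bigD1 i)//= expr0n (negbTE mi) mul0r.
under eq_bigr do rewrite E.
have [h|h] := boolP (mpoly.mnm0 \in mpoly.msupp P).
  rewrite (bigD1_seq mpoly.mnm0) ?mpoly.msupp_uniq//= eqxx mulr1 big1 ?addr0// => m.
  by move=> /negbTE ->; rewrite mulr0.
rewrite [RHS]mpoly.memN_msupp_eq0// big_seq big1// => m mP.
by case: eqP => [m0|_]; rewrite ?mulr0//; rewrite m0 (negbTE h) in mP.
Qed.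

Lemma meval_le d (P : mpoly.mpoly d C) (B : R) :
  mpoly.mcoeff mpoly.mnm0 P = 0 -> 0 <= B ->
  exists2 K : R, 0 <= K & forall z : 'I_d -> C, (forall i, normc (z i) <= B) ->
    normc (mpoly.meval z P) <= K * \sum_i normc (z i).
Proof.
move=> P0 B0; pose B' := 1 + B; have B'1 : 1 <= B' by rewrite lerDl.
have B'0 : 0 <= B' by rewrite addr_ge0.
exists (\sum_(m <- mpoly.msupp P) normc (mpoly.mcoeff m P) * \prod_i B' ^+ m i).
  by apply: sumr_ge0 => m _; rewrite mulr_ge0 ?normc_ge0// prodr_ge0// => i _; exact: exprn_ge0.
move=> z zB; rewrite mpoly.mevalE (le_trans (normc_sum _ _))// mulr_suml.
rewrite big_seq [leRHS]big_seq; apply: ler_sum => m mP.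
rewrite normcM normc_prod -mulrA ler_wpM2l ?normc_ge0//.
have [i mi] : exists i, m i != 0%N.
  apply/existsP; apply: contraTT mP; rewrite negb_exists => /forallP m0.
  suff -> : m = mpoly.mnm0 by rewrite mpoly.mcoeff_msupp P0 eqxx.
  by apply/mpoly.mnmP => i; rewrite mpoly.mnm0E; apply/eqP; rewrite -[_ == _]negbK.
have zB' j : normc (z j) <= B' by rewrite (le_trans (zB j))// lerDr.
apply: (@le_trans _ _ ((\prod_i B' ^+ m i) * normc (z i))); last first.
  rewrite ler_wpM2l ?prodr_ge0// => [j _|]; first exact: exprn_ge0.
  by rewrite (bigD1 i)//= lerDl sumr_ge0// => j _; exact: normc_ge0.
rewrite (bigD1 i)//= [in leRHS](bigD1 i)//= mulrAC ler_pM ?normc_ge0//.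
- by apply: prodr_ge0 => j _; exact: normc_ge0.
- rewrite normcX; case: (m i) mi => // k _.
  rewrite exprSr ler_wpM2r ?normc_ge0// exprS (@le_trans _ _ (B' ^+ k))//.
    by rewrite lerXn2r// nnegrE ?normc_ge0.
  by rewrite ler_peMl ?exprn_ge0.
- apply: ler_prod => j _; rewrite normc_ge0 normcX/=.
  by rewrite lerXn2r// nnegrE ?normc_ge0.
Qed.

Lemma digits_inj (D N : nat) (a b : nat -> nat) :
  (forall j, a j < D)%N -> (forall j, b j < D)%N ->
  (\sum_(j < N) a j * D ^ j = \sum_(j < N) b j * D ^ j)%N ->
  forall j, (j < N)%N -> a j = b j.
Proof.
elim: N a b => // N IH a b aD bD; rewrite !big_ord_recl/= !expn0 !muln1.
have shift (f : nat -> nat) : (\sum_(i < N) f (bump 0 i) * D ^ bump 0 i =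
    (\sum_(i < N) f i.+1 * D ^ i) * D)%N.
  by rewrite big_distrl/=; apply: eq_bigr => i _; rewrite expnS mulnCA mulnC.
rewrite !shift => ab.
have ab0 : a 0%N = b 0%N.
  have := congr1 (modn^~ D) ab; rewrite /= ![(_ 0%N + _)%N]addnC !modnMDl.
  by rewrite !modn_small.
have D0 : (0 < D)%N by exact: leq_ltn_trans (aD 0%N).
move: ab; rewrite ab0 => /addnI/eqP; rewrite eqn_pmul2r// => /eqP ab.
by case=> // j; rewrite ltnS; exact: (IH (fun j => a j.+1) (fun j => b j.+1)).
Qed.

(** The numbers [a i] are digits in base [D], placed at the distinct positions
    [sigma i]. *)
Lemma kronecker_inj (D d : nat) (sigma : 'I_d -> nat) (a b : 'I_d -> nat) :
  (0 < D)%N -> injective sigma -> (forall i, a i < D)%N -> (forall i, b i < D)%N ->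
  (\sum_i a i * D ^ sigma i = \sum_i b i * D ^ sigma i)%N -> a =1 b.
Proof.
move=> D0 sI aD bD ab i.
pose N := (\max_i (sigma i)).+1.
have sN k : (sigma k < N)%N by rewrite ltnS leq_bigmax.
pose ext (f : 'I_d -> nat) j := (\sum_(k | sigma k == j) f k)%N.
have extE f k : ext f (sigma k) = f k.
  rewrite /ext (big_pred1 k)// => l /=.
  by apply/eqP/eqP => [/sI|->].
have extD f : (forall k, f k < D)%N -> forall j, (ext f j < D)%N.
  move=> fD j; have [[k <-]|nk] := pselect (exists k, sigma k = j).
    by rewrite extE.
  by rewrite /ext big_pred0// => k; apply/eqP => kj; apply: nk; exists k.
have extS f : (\sum_(j < N) ext f j * D ^ j = \sum_k f k * D ^ sigma k)%N.
  rewrite (eq_bigr (fun j : 'I_N => \sum_(k | sigma k == j) f k * D ^ j))%N; last first.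
    by move=> j _; rewrite -big_distrl.
  rewrite (exchange_big_dep xpredT)//=; apply: eq_bigr => k _.
  by rewrite (big_pred1 (Ordinal (sN k)))// => j /=; rewrite eq_sym.
have := @digits_inj D N _ _ (extD a aD) (extD b bD).
by rewrite !extS => /(_ ab (sigma i) (sN i)); rewrite !extE.
Qed.

Lemma poly_lowest_term (q : {poly C}) : q != 0 -> q.[0] = 0 ->
  exists (m : nat) (c : C) (K : R), [/\ (0 < m)%N, c != 0, 0 <= K &
    forall t, normc t <= 1 -> normc (q.[t] - c * t ^+ m) <= K * normc t ^+ m.+1].
Proof.
move=> q0 q00.
have ex : exists m, q`_m != 0.
  by exists (size q).-1; rewrite -lead_coefE lead_coef_eq0.
case: (ex_minnP ex) => m qm mmin.
have below0 i : (i < m)%N -> q`_i = 0.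
  by move=> im; apply/eqP; apply: contraTT im => /mmin; rewrite -leqNgt.
have msz : (m < size q)%N.
  by rewrite ltnNge; apply: contra qm => /(nth_default 0) ->.
exists m, q`_m, (\sum_(i < size q) normc q`_i); split=> //.
- by rewrite lt0n; apply: contra_neq qm => ->; rewrite -horner_coef0.
- by apply: sumr_ge0 => i _; exact: normc_ge0.
move=> t t1; rewrite horner_coef (bigD1 (Ordinal msz))// [X in X - _]addrC addrK.
rewrite mulr_suml big_mkcond/= (le_trans (normc_sum _ _))//.
apply: ler_sum => i _; case: ifPn => [im|_]; last first.
  by rewrite normc0 mulr_ge0 ?exprn_ge0 ?normc_ge0.
have [lim|] := ltnP i m; first by rewrite below0// mul0r normc0 mul0r.
rewrite leq_eqVlt => /orP[/eqP mi|mi].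
  by case/eqP: im; apply: val_inj.
rewrite normcM normcX ler_wpM2l ?normc_ge0// -(subnKC mi) exprD.
by rewrite ler_piMr ?exprn_ge0 ?normc_ge0// exprn_ile1 ?normc_ge0.
Qed.

(** Substituting the powers [t^(D^sigma i)] with [D] above all exponents turns
    distinct monomials into distinct powers of [t], so that a nonzero
    univariate polynomial results; near 0 it is governed by its lowest term. *)
Lemma kronecker_lowest_term d (P : mpoly.mpoly d C) (sigma : 'I_d -> nat) :
  injective sigma -> P != 0 -> mpoly.mcoeff mpoly.mnm0 P = 0 ->
  exists (D m : nat) (c : C) (K : R), [/\ (0 < D)%N, (0 < m)%N, c != 0, 0 <= K &
    forall t, normc t <= 1 ->
    normc (mpoly.meval (fun i => t ^+ (D ^ sigma i)) P - c * t ^+ m)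
      <= K * normc t ^+ m.+1].
Proof.
move=> sI P0 Pc; pose D := mpoly.msize P.
have [m0 m0P] : exists m0, m0 \in mpoly.msupp P.
  move: P0; rewrite -mpoly.msupp_eq0; case: (mpoly.msupp P) => // m r _.
  by exists m; rewrite mem_head.
have mD m i : m \in mpoly.msupp P -> (m i < D)%N.
  move=> /mpoly.msize_mdeg_lt; apply: leq_ltn_trans.
  by rewrite mpoly.mdegE (bigD1 i)//= leq_addr.
have D0 : (0 < D)%N by exact: leq_ltn_trans (mpoly.msize_mdeg_lt m0P).
pose code (m : mpoly.multinom d) := (\sum_i m i * D ^ sigma i)%N.
pose q : {poly C} := \sum_(m <- mpoly.msupp P) mpoly.mcoeff m P *: 'X^(code m).
have qE t : q.[t] = mpoly.meval (fun i => t ^+ (D ^ sigma i)) P.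
  rewrite mpoly.mevalE horner_sum; apply: eq_bigr => m _.
  rewrite hornerZ hornerXn; congr (_ * _).
  rewrite /code -prodrXr; apply: eq_bigr => i _.
  by rewrite mulnC exprM.
have q0 : q != 0.
  apply: contraTneq m0P => q0; rewrite mpoly.mcoeff_msupp negbK.
  move: (congr1 (fun p : {poly C} => p`_(code m0)) q0).
  have [m0P|/mpoly.memN_msupp_eq0 ->//] := boolP (m0 \in mpoly.msupp P).
  rewrite coef0 coef_sum (bigD1_seq m0) ?mpoly.msupp_uniq//= coefZ coefXn eqxx mulr1.
  rewrite big_seq_cond big1 ?addr0 => [->//|m /andP[mP mm0]].
  rewrite coefZ coefXn; case: eqP => [cm|]; last by rewrite mulr0.
  case/eqP: mm0; apply/mpoly.mnmP.
  by apply: (kronecker_inj D0 sI) => [i|i|]; [exact: mD|exact: mD|].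
have q00 : q.[0] = 0.
  rewrite qE (_ : mpoly.meval _ P = mpoly.meval (fun=> 0) P).
    by rewrite meval_at0.
  apply: mpoly.meval_eq => i.
  by rewrite expr0n expn_eq0 -leqn0 leqNgt D0.
have [m [c [K [m1 c0 K0 h]]]] := poly_lowest_term q0 q00.
by exists D, m, c, K; split=> // t /h; rewrite qE.
Qed.

End Polynomials.

(** * A countable dense family of finitely supported functions *)

Section RationalFunctions.
Context (R : realType) (V : countType) (s : space_kind R).
Notation X := (tree_space V s).
Notation fincode := (seq (V * (rat * rat))).

(** A list of vertices with Gaussian rationals; the values attached to the same
    vertex are added. *)
Definition code_val (l : fincode) (v : V) : R[i] :=
  \sum_(p <- l | p.1 == v) (ratr p.2.1 +i* ratr p.2.2).

Definition code_supp (l : fincode) : seq V := map fst l.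

Definition code_fun (l : fincode) : X := restr s (code_supp l) (code_val l).

Lemma code_val_out l v : v \notin code_supp l -> code_val l v = 0.
Proof.
move=> vl; rewrite /code_val big_seq_cond big1// => p /andP[pl /eqP pv].
by case/negP: vl; apply/mapP; exists p.
Qed.

Lemma coord_code_fun l v : code_fun l v = code_val l v.
Proof. by rewrite /code_fun coord_restr; case: ifPn => // /code_val_out ->. Qed.

Lemma rat_approx (z : R[i]) (e : R) : 0 < e ->
  exists q : rat * rat, normc (z - (ratr q.1 +i* ratr q.2)) < e.
Proof.
move=> e0; have e20 : 0 < e / 2 by rewrite divr_gt0.
have approx (x : R) : exists q : rat, `|x - ratr q| < e / 2.
  have [|q] := @rat_in_itvoo R (x - e / 2) (x + e / 2); first lra.
  by rewrite in_itv/= => /andP[h1 h2]; exists q; rewrite ltr_norml; apply/andP; split; lra.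
case: z => x y; have [[p hp] [q hq]] := (approx x, approx y); exists (p, q).
rewrite [X in normc X](_ : _ = (x - ratr p)%:C + 'i * (y - ratr q)%:C); last first.
  by rewrite [LHS]complexE.
apply: le_lt_trans (le_normcD _ _) _; rewrite normcM !normc_real.
have -> : normc 'i = 1 :> R by rewrite /= expr0n expr1n add0r sqrtr1.
lra.
Qed.

Lemma code_fun_dense (g : X) (e : R) : 0 < e -> exists l, nrm (code_fun l - g) < e.
Proof.
move=> e0; have e20 : 0 < e / 2 by rewrite divr_gt0.
have [A hA] := restr_dense g e20.
pose N : R := (size (undup A)).+1%:R.
have N0 : 0 < N by rewrite ltr0Sn.
have [q hq] := choice (fun u => rat_approx (g u) (divr_gt0 e20 N0)).
pose l := [seq (u, q u) | u <- undup A]; exists l.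
have lE u : code_val l u = if u \in A then ratr (q u).1 +i* ratr (q u).2 else 0.
  rewrite /code_val big_map/=; case: ifPn => uA.
    rewrite -big_filter (_ : [seq _ <- _ | _] = [:: u]) ?big_seq1//.
    by rewrite filter_pred1_uniq ?undup_uniq// mem_undup.
  rewrite big_seq_cond big1// => v /andP[]; rewrite mem_undup => vA /eqP vu.
  by rewrite vu (negbTE uA) in vA.
have -> : code_fun l - g = restr s A (fun u => code_val l u - g u) - (g - restr s A g).
  apply: space_ext => u; rewrite !coordB coord_code_fun !coord_restr.
  by case: ifPn => uA; [ring | rewrite lE (negbTE uA); ring].
apply: le_lt_trans (nrmB _ _) _.
suff : nrm (restr s A (fun u => code_val l u - g u)) <= e / 2 by lra.
apply: le_trans (nrm_restr _ _ _) _.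
apply: (@le_trans _ _ (\sum_(u <- undup A) e / 2 / N)).
  rewrite big_seq [leRHS]big_seq; apply: ler_sum => u; rewrite mem_undup => uA.
  by rewrite lE uA -normcN opprB ltW.
rewrite big_const_seq count_predT iter_addr addr0 -[_ *+ size _]mulr_natr mulrAC ler_pdivrMr//.
by rewrite ler_wpM2l ?ler_nat// ltW.
Qed.

End RationalFunctions.

(** * The bumps and the generators *)

Section LinearIterates.
Context (R : realType) (V : countType) (s : space_kind R).
Notation X := (tree_space V s).
Variable T : {linear X -> X}.

Lemma iterTB n (f g : X) : iter n T (f - g) = iter n T f - iter n T g.
Proof. by elim: n => //= n ->; rewrite linearB. Qed.

Lemma iterTD n (f g : X) : iter n T (f + g) = iter n T f + iter n T g.
Proof. by elim: n => //= n ->; rewrite linearD. Qed.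

Lemma iterTZ n z (f : X) : iter n T (z *: f) = z *: iter n T f.
Proof. by elim: n => //= n ->; rewrite linearZ. Qed.

Lemma iterT_sum n (I : Type) (r : seq I) (F : I -> X) :
  iter n T (\sum_(i <- r) F i) = \sum_(i <- r) iter n T (F i).
Proof. by elim: n => //= n ->; rewrite linear_sum. Qed.

Lemma iterT_nrm (C : R) : 0 <= C -> (forall f, nrm (T f) <= C * nrm f) ->
  forall n f, nrm (iter n T f) <= C ^+ n * nrm f.
Proof.
move=> C0 TC; elim=> [|n IH] f /=; first by rewrite expr0 mul1r.
by apply: le_trans (TC _) _; rewrite exprS -mulrA ler_wpM2l.
Qed.

End LinearIterates.

Section Construction.
Context (R : realType) (V : countType) (s : space_kind R).
Notation X := (tree_space V s).
Variables (T : {linear X -> X}) (up : nat -> V -> option V).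
Variables (w : nat -> V -> R) (S : nat -> V -> V) (C : R).
(* All that is needed of the tree: an [n]-th ancestor map [up n], the weight
   [w n u] of the way up, which tends to 0 for fixed [u], and an [n]-th
   descendant [S n v] of each vertex such that, at suitable times [n], the
   weights of the ways up to finitely many given [v] are all large. *)
Hypothesis T_delta : forall n u, iter n T (delta s u) =
  if up n u is Some v then (w n u)%:C *: delta s v else 0.
Hypothesis up_S : forall n v, up n (S n v) = Some v.
Hypothesis w_ge0 : forall n u, 0 <= w n u.
Hypothesis C1 : 1 <= C.
Hypothesis T_le : forall f : X, nrm (T f) <= C * nrm f.
Hypothesis w_to0 : forall u (e : R), 0 < e ->
  exists N, forall n, (N <= n)%N -> w n u <= e.
Hypothesis w_large : forall (A : seq V) (K : R) N,
  exists2 n, (N <= n)%N & forall v, v \in A -> K <= w n (S n v).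

(* Step [k] is given the base of the exponents, the degree to be matched, both
   shifted by one to be positive, and the function to be approximated. *)
Variable e : nat -> (nat * nat * seq (V * (rat * rat)))%type.
Hypothesis e_often : forall a N, exists2 k, (N <= k)%N & e k = a.

Let C0 : 0 < C. Proof. exact: lt_le_trans C1. Qed.
Let CX n : 0 < C ^+ n. Proof. exact: exprn_gt0. Qed.

Definition base k := (e k).1.1.+1.
Definition deg k := (e k).1.2.+1.
Definition target k := (e k).2.
Definition supp k := code_supp (target k).

(** If each of the at most [size (supp k)] values of a bump is this small, then
    the whole bump has l^1 norm at most [2^-k / C^N], which [T^N] enlarges to
    at most [2^-k]. *)
Definition step_tol k N : R := 2^-1 ^+ k / ((size (supp k)).+1%:R * C ^+ N).

Lemma step_tol_gt0 k N : 0 < step_tol k N.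
Proof. by rewrite divr_gt0 ?mulr_gt0 ?exprn_gt0 ?invr_gt0. Qed.

(** A suitable time [n] for step [k], when [F] is the set of vertices used so far
    and [N] is the preceding time: the weights on [F] have become small, while
    those on the new block are so large that the bump is below tolerance. *)
Definition good_step k (F : seq V) N n := [/\ (N < n)%N,
  \sum_(u <- undup F) w n u <= 2^-1 ^+ k &
  forall v, v \in supp k -> 1 < w n (S n v) /\
    normc (code_val R (target k) v) / w n (S n v) <= step_tol k N ^+ deg k].

Lemma sum_w_to0 (F : seq V) (a : R) : 0 < a ->
  exists N, forall n, (N <= n)%N -> \sum_(u <- F) w n u <= a.
Proof.
elim: F a => [|u F IH] a a0; first by exists 0%N => n _; rewrite big_nil ltW.
have a20 : 0 < a / 2 by rewrite divr_gt0.
have [[N1 h1] [N2 h2]] := (w_to0 u a20, IH _ a20).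
exists (maxn N1 N2) => n; rewrite geq_max => /andP[/h1 + /h2].
by rewrite big_cons; lra.
Qed.

Lemma good_step_exists k F N : exists n, good_step k F N n.
Proof.
have [N1 h1] := @sum_w_to0 (undup F) (2^-1 ^+ k) ltac:(by rewrite exprn_gt0 ?invr_gt0).
have t0 := exprn_gt0 (deg k) (step_tol_gt0 k N).
pose Y := \sum_(v <- supp k) normc (code_val R (target k) v).
have Y0 : 0 <= Y by apply: sumr_ge0 => v _; exact: normc_ge0.
have [n nN hn] := w_large (supp k) (Y / step_tol k N ^+ deg k + 2) (maxn N1 N.+1).
exists n; move: nN; rewrite geq_max => /andP[nN1 nN]; split=> //; first exact: h1.
move=> v vs; have := hn v vs.
have YT : 0 <= Y / step_tol k N ^+ deg k by rewrite divr_ge0// ltW.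
move=> big; have w1 : 1 < w n (S n v) by lra.
split=> //; rewrite ler_pdivrMr; last exact: lt_trans w1.
have vY : normc (code_val R (target k) v) <= Y.
  rewrite /Y (big_rem v)//= lerDl sumr_ge0// => x _; exact: normc_ge0.
apply: le_trans vY _; rewrite mulrC -ler_pdivrMr//.
lra.
Qed.

Definition next_time k F N := xget 0%N [set n | good_step k F N n].

Lemma next_timeP k F N : good_step k F N (next_time k F N).
Proof. by have [n hn] := good_step_exists k F N; exact: (@xgetI _ _ _ n hn). Qed.

(** The vertices used before step [k] and the time of the preceding step. *)
Fixpoint history k : seq V * nat :=
  if k is k'.+1 then
    let F := (history k').1 ++ supp k' in
    let n := next_time k' F (history k').2 in
    (F ++ map (S n) (supp k'), n)
  else ([::], 0%N).

Definition past k := (history k).1 ++ supp k.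
Definition time k := (history k.+1).2.
Definition block k := map (S (time k)) (supp k).

Lemma timeP k : good_step k (past k) (history k).2 (time k).
Proof. exact: next_timeP. Qed.

Lemma history_sub j k : (j <= k)%N -> {subset (history j).1 <= (history k).1}.
Proof.
move=> /subnKC <-; elim: (k - j)%N => [|m IH]; first by rewrite addn0.
by rewrite addnS => x /IH xj; rewrite /= !mem_cat xj.
Qed.

Lemma supp_past i k : (i <= k)%N -> {subset supp i <= past k}.
Proof.
rewrite leq_eqVlt => /orP[/eqP -> x xk|ik x xi]; first by rewrite mem_cat xk orbT.
by rewrite mem_cat (history_sub ik)// /= !mem_cat xi orbT.
Qed.

Lemma block_past j k : (j < k)%N -> {subset block j <= past k}.
Proof. by move=> jk x xj; rewrite mem_cat (history_sub jk)// /= mem_cat xj orbT. Qed.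

Lemma time_history j k : (j < k)%N -> (time j <= (history k).2)%N.
Proof.
move=> /subnKC <-; elim: (k - j.+1)%N => [|m IH]; first by rewrite addn0.
rewrite addnS; apply: leq_trans IH _; apply: ltnW.
by have [] := timeP (j.+1 + m).
Qed.

(** Weights at time [time k] are at most 1 on the past and exceed 1 on the
    block. *)
Lemma block_notin_past k u : u \in block k -> u \notin past k.
Proof.
move=> /mapP[v vk ->]; apply/negP => uF.
have [_ small /(_ v vk)[large _]] := timeP k.
have : w (time k) (S (time k) v) <= \sum_(u <- undup (past k)) w (time k) u.
  rewrite (bigD1_seq (S (time k) v)) ?mem_undup ?undup_uniq//= lerDl.
  by apply: sumr_ge0 => x _; exact: w_ge0.
have : (2^-1 ^+ k : R) <= 1 by rewrite exprn_ile1 ?invr_ge0// invf_le1// ler1n.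
lra.
Qed.

Lemma block_disjoint j k u : u \in block j -> u \in block k -> j = k.
Proof.
wlog jk : j k / (j <= k)%N => [H uj uk|uj uk].
  by have [/H|/ltnW/H kj] := leqP j k; [exact|exact/esym/kj].
move: jk; rewrite leq_eqVlt => /orP[/eqP//|jk].
by have := block_notin_past uk; rewrite (block_past jk uj).
Qed.

(** The root makes [T^(time k)] map the [deg k]-th power of the bump exactly to
    the target function, see [bump_pow]. *)
Definition bump_val k u : R[i] :=
  if up (time k) u is Some v then
    if u == S (time k) v
    then (deg k).-root (code_val R (target k) v / (w (time k) u)%:C) else 0
  else 0.

Lemma bump_block k u : bump_val k u != 0 -> u \in block k.
Proof.
rewrite /bump_val; case: (up _ u) => [v|]; last by rewrite eqxx.
case: (u =P _) => [->|]; last by rewrite eqxx.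
have [vs _|/code_val_out ->] := boolP (v \in supp k).
  by apply/mapP; exists v.
by rewrite mul0r rootC0 eqxx.
Qed.

Lemma bump_pow k v : v \in supp k ->
  (w (time k) (S (time k) v))%:C * bump_val k (S (time k) v) ^+ deg k
    = code_val R (target k) v.
Proof.
move=> vk; rewrite /bump_val up_S eqxx rootCK// mulrCA mulfV ?mulr1//.
have [_ _ /(_ v vk)[w1 _]] := timeP k.
rewrite -[0](@complexr0 R) (inj_eq (@complexI R)) gt_eqF//; exact: lt_trans w1.
Qed.

Lemma bump_le k u : normc (bump_val k u) <= step_tol k (history k).2.
Proof.
have [->|/bump_block/mapP[v vk ->]] := eqVneq (bump_val k u) 0.
  by rewrite normc0 ltW// step_tol_gt0.
have [_ _ /(_ v vk)[w1 small]] := timeP k.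
have w0 : 0 < w (time k) (S (time k) v) by exact: lt_trans w1.
rewrite -(@ler_pXn2r _ (deg k))// ?nnegrE ?normc_ge0 ?(ltW (step_tol_gt0 _ _))//.
move: small; rewrite -(bump_pow vk) normcM normc_real gtr0_norm// mulrAC.
by rewrite divff ?gt_eqF// mul1r normcX.
Qed.

Lemma bump_le_half k u : normc (bump_val k u) <= 2^-1 ^+ k.
Proof.
apply: le_trans (bump_le k u) _; rewrite ler_pdivrMr; last by rewrite mulr_gt0.
rewrite ler_peMr ?exprn_ge0 ?invr_ge0//.
by rewrite mulr_ege1 ?ler1n// exprn_ege1.
Qed.

Lemma bump_le1 k u : normc (bump_val k u) <= 1.
Proof.
apply: le_trans (bump_le_half k u) _.
by rewrite exprn_ile1 ?invr_ge0// invf_le1// ler1n.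
Qed.

Lemma sum_block k : \sum_(u <- undup (block k)) normc (bump_val k u)
  <= 2^-1 ^+ k / C ^+ (history k).2.
Proof.
apply: (@le_trans _ _ (\sum_(u <- undup (block k)) step_tol k (history k).2)).
  by apply: ler_sum => u _; exact: bump_le.
rewrite big_const_seq count_predT iter_addr addr0 -[_ *+ size _]mulr_natr.
rewrite /step_tol invfM mulrA mulrAC ler_wpM2r ?invr_ge0 ?(ltW (CX _))//.
rewrite mulrAC ler_pdivrMr// ler_wpM2l ?exprn_ge0 ?invr_ge0// ler_nat.
by rewrite (leq_trans (size_undup _))// size_map.
Qed.

(** Blocks are disjoint, so a vertex determines its block; the junk value 0 outside
    all blocks is harmless, as generators only use blocks of positive
    index. *)
Definition block_of u : nat := xget 0%N [set k | u \in block k].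

Lemma block_ofE k u : u \in block k -> block_of u = k.
Proof.
move=> uk; have := @xgetI _ 0%N [set k | u \in block k] k uk.
by move=> /block_disjoint; exact.
Qed.

Definition bump_at u := normc (bump_val (block_of u) u).

(** The bump of block [j > k] was chosen small compared with [C^-n] for the
    preceding time [n], and [n >= time k]. *)
Lemma sum_tail k (A : seq V) : uniq A ->
  \sum_(u <- A | (k < block_of u)%N) bump_at u <= 2^-1 ^+ k / C ^+ time k.
Proof.
move=> uA; pose N := (\max_(u <- A) block_of u).+1.
have geo M : \sum_(j < M.+1 | (k < j)%N) (2^-1 : R) ^+ j <=
    2^-1 ^+ k - 2^-1 ^+ (maxn k M).
  elim: M => [|M IH]; first by rewrite big_mkcond big_ord_recl big_ord0/= maxn0 subrr addr0.
  rewrite big_mkcond big_ord_recr/= -big_mkcond/=.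
  have [kM|Mk] := ltnP k M.+1; last first.
    rewrite addr0; apply: le_trans IH _.
    by rewrite (maxn_idPl (ltnW Mk)).
  apply: le_trans (lerD IH (lexx _)) _.
  have -> : maxn k M = M by apply/maxn_idPr.
  by rewrite exprS; lra.
have -> : \sum_(u <- A | (k < block_of u)%N) bump_at u =
    \sum_(j < N | (k < j)%N) \sum_(u <- A | block_of u == j) bump_at u.
  rewrite (exchange_big_dep (fun u => k < block_of u)%N)/=; last first.
    by move=> j u kj /eqP ->.
  rewrite big_seq_cond [RHS]big_seq_cond; apply: eq_bigr => u /andP[uIA ku].
  have uN : (block_of u < N)%N by rewrite ltnS (@leq_bigmax_seq _ A xpredT).
  rewrite (big_pred1 (Ordinal uN))// => j /=.
  by apply/andP/eqP => [[_ /eqP h]|->//]; exact: val_inj.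
apply: (@le_trans _ _ (\sum_(j < N | (k < j)%N) 2^-1 ^+ j / C ^+ time k)).
  apply: ler_sum => j kj.
  apply: (@le_trans _ _ (2^-1 ^+ j / C ^+ (history j).2)); last first.
    rewrite ler_wpM2l ?exprn_ge0 ?invr_ge0// lef_pV2 ?posrE//.
    by rewrite ler_weXn2l// time_history.
  apply: le_trans (sum_block j).
  rewrite (bigID (fun u => u \in block j))/= [X in _ + X]big1 ?addr0; last first.
    move=> u /andP[/eqP uj unj]; rewrite /bump_at uj.
    have [->|/bump_block ub] := eqVneq (bump_val j u) 0; first by rewrite normc0.
    by rewrite ub in unj.
  rewrite (eq_bigr (fun u => normc (bump_val j u))); last first.
    by move=> u /andP[/eqP uj _]; rewrite /bump_at uj.
  rewrite -big_filter; apply: ler_sum_subset.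
  - by move=> u; exact: normc_ge0.
  - by rewrite filter_uniq.
  - by move=> u; rewrite mem_filter mem_undup => /andP[/andP[]].
by rewrite -mulr_suml ler_wpM2r ?invr_ge0 ?(ltW (CX _))// (le_trans (geo _))// gerBl exprn_ge0// invr_ge0.
Qed.

(** The infinite sum of the powers of bumps with index above [i]; at each vertex
    at most one of them is nonzero. *)
Definition gen_tail i u : R[i] :=
  if (i < block_of u)%N then bump_val (block_of u) u ^+ (base (block_of u) ^ i) else 0.

Lemma gen_tail_le i u :
  normc (gen_tail i u) <= if (i < block_of u)%N then bump_at u else 0.
Proof.
rewrite /gen_tail; case: ifP => _; last by rewrite normc0.
have : (0 < base (block_of u) ^ i)%N by rewrite expn_gt0.
case: (_ ^ _)%N => // n _; rewrite normcX exprS ler_piMr ?normc_ge0//.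
by rewrite exprn_ile1 ?normc_ge0 ?bump_le1.
Qed.

Lemma generator_exists i : exists g : X,
  (forall u, g u = code_val R (target i) u + gen_tail i u) /\
  nrm (g - code_fun s (target i)) <= 2^-1 ^+ i.
Proof.
have [||t tE tN] := @l1_element R V s (gen_tail i) (2^-1 ^+ i).
- by rewrite exprn_ge0 ?invr_ge0.
- move=> A uA; apply: le_trans (ler_sum _ (fun u _ => gen_tail_le i u)) _.
  rewrite -big_mkcond/=; apply: le_trans (sum_tail i uA) _.
  by rewrite ler_piMr ?exprn_ge0 ?invr_ge0// invf_le1// exprn_ege1.
exists (code_fun s (target i) + t); split; last by rewrite addrC addKr.
by move=> u; rewrite coordD coord_code_fun tE.
Qed.

(** * Orbits of polynomials in the generators *)

Section Orbit.
Variable G : nat -> X.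
Hypothesis GE : forall i u, G i u = code_val R (target i) u + gen_tail i u.
Variables (d : nat) (sigma : 'I_d -> nat) (P : mpoly.mpoly d R[i]) (f : X).
Hypothesis fE : forall v, f v = mpoly.meval (fun i => G (sigma i) v) P.

Lemma gen_on_block k i u : (i < k)%N -> u \in block k ->
  G i u = bump_val k u ^+ (base k ^ i).
Proof.
move=> ik uk; rewrite GE /gen_tail (block_ofE uk) ik code_val_out ?add0r//.
by apply: contra (block_notin_past uk); apply: supp_past; exact: ltnW.
Qed.

Lemma gen_off_block k i u : (i < k)%N -> u \notin past k -> u \notin block k ->
  normc (G i u) <= if (k < block_of u)%N then bump_at u else 0.
Proof.
move=> ik uF ub; rewrite GE code_val_out ?add0r; last first.
  by apply: contra uF; apply: supp_past; exact: ltnW.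
apply: le_trans (gen_tail_le i u) _.
have [_|jk] := ltnP k (block_of u); first by case: ifP => // _; exact: normc_ge0.
case: ifP => // _; rewrite /bump_at.
have [->|/bump_block uj] := eqVneq (bump_val (block_of u) u) 0; first by rewrite normc0.
move: jk; rewrite leq_eqVlt => /orP[/eqP jk|jk].
  by rewrite -jk uj in ub.
by rewrite (block_past jk uj) in uF.
Qed.

(** The weights on the past of step [k] add up to at most [2^-k] at its time. *)
Lemma past_part k : nrm (iter (time k) T (restr s (past k) f)) <= 2^-1 ^+ k * nrm f.
Proof.
rewrite /restr iterT_sum (le_trans (nrm_sum _ _))//.
have [_ small _] := timeP k; rewrite mulrC.
apply: le_trans (ler_wpM2l (nrm_ge0 f) small); rewrite mulr_sumr.
apply: ler_sum => u _; rewrite iterTZ nrmZ ler_pM ?normc_ge0 ?nrm_ge0 ?coord_le_nrm//.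
rewrite T_delta; case: (up _ u) => [v|]; last by rewrite nrm0 w_ge0.
by rewrite nrmZ normc_real ger0_norm ?w_ge0// ler_piMr ?w_ge0 ?nrm_delta.
Qed.

Lemma S_inj n : injective (S n).
Proof. by move=> u v uv; have := up_S n u; rewrite uv up_S => -[]. Qed.

(** On the block [f] is the univariate polynomial [P(t^(base k ^ sigma i))] at
    the value [t] of the bump; the term [c t^(deg k)] is carried exactly to the
    multiple [c] of the target, and the error has an additional factor [t]. *)
Lemma block_part k (c : R[i]) (K : R) : 0 <= K -> (forall i, sigma i < k)%N ->
  (forall t, normc t <= 1 ->
    normc (mpoly.meval (fun i => t ^+ (base k ^ sigma i)) P - c * t ^+ deg k)
      <= K * normc t ^+ (deg k).+1) ->
  nrm (iter (time k) T (restr s (block k) f) - c *: code_fun s (target k))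
    <= 2^-1 ^+ k * (K * \sum_(v <- undup (supp k)) normc (code_val R (target k) v)).
Proof.
move=> K0 sk PK; rewrite /restr iterT_sum undup_map_inj; last exact: S_inj.
rewrite big_map /code_fun /restr scaler_sumr -sumrB (le_trans (nrm_sum _ _))//.
rewrite 2!mulr_sumr big_seq [leRHS]big_seq; apply: ler_sum => v; rewrite mem_undup => vk.
rewrite iterTZ T_delta up_S !scalerA -scalerBl nrmZ.
set u := S (time k) v; set t := bump_val k u.
have ub : u \in block k by apply/mapP; exists v.
have ft : f u = mpoly.meval (fun i => t ^+ (base k ^ sigma i)) P.
  by rewrite fE; apply: mpoly.meval_eq => i; rewrite (gen_on_block (sk i) ub).
have w0 : 0 <= w (time k) u by exact: w_ge0.
rewrite -(bump_pow vk) -/u -/t ft.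
set Q := mpoly.meval _ P.
have -> : Q * (w (time k) u)%:C - c * ((w (time k) u)%:C * t ^+ deg k) =
  (w (time k) u)%:C * (Q - c * t ^+ deg k) by ring.
rewrite !normcM normc_real ger0_norm// -[leRHS]mulr1.
apply: ler_pM; rewrite ?mulr_ge0 ?normc_ge0 ?nrm_ge0 ?nrm_delta//.
apply: le_trans (ler_wpM2l w0 (PK t (bump_le1 _ _))) _.
rewrite normcX exprS.
have -> : w (time k) u * (K * (normc t * normc t ^+ deg k)) =
  normc t * (K * (w (time k) u * normc t ^+ deg k)) by ring.
by rewrite ler_wpM2r ?bump_le_half// !mulr_ge0// exprn_ge0 ?normc_ge0.
Qed.

(** Off the past and the block only bumps with index above [k] are seen, and these
    were chosen small enough to absorb the factor [C^(time k)]. *)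
Lemma tail_part k (K : R) : 0 <= K -> (forall i, sigma i < k)%N ->
  (forall v, normc (f v) <= K * \sum_i normc (G (sigma i) v)) ->
  nrm (iter (time k) T (f - restr s (past k) f - restr s (block k) f))
    <= 2^-1 ^+ k * (K * d%:R).
Proof.
move=> K0 sk fK; have Kd : 0 <= K * d%:R by rewrite mulr_ge0.
apply: le_trans (iterT_nrm (ltW C0) T_le _ _) _.
rewrite mulrC -ler_pdivlMr// mulrAC mulrC.
set h := f - _ - _.
have [] // := @l1_space R V s h (K * d%:R * (2^-1 ^+ k / C ^+ time k)).
  by rewrite mulr_ge0// divr_ge0 ?exprn_ge0 ?invr_ge0// ltW.
move=> A uA.
apply: le_trans (ler_wpM2l Kd (sum_tail k uA)); rewrite [in leRHS]big_mkcond mulr_sumr.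
apply: ler_sum => u _; rewrite /h !coordB !coord_restr.
have b0 : 0 <= if (k < block_of u)%N then bump_at u else 0.
  by case: ifP => // _; exact: normc_ge0.
have [uF|uF] := boolP (u \in past k).
  have [/block_notin_past|ub] := boolP (u \in block k); first by rewrite uF.
  by rewrite subrr subr0 normc0 mulr_ge0.
have [ub|ub] := boolP (u \in block k).
  by rewrite subr0 subrr normc0 mulr_ge0.
rewrite !subr0; apply: le_trans (fK u) _; rewrite -mulrA ler_wpM2l//.
apply: le_trans (ler_sum _ (fun i _ => gen_off_block (sk i) uF ub)) _.
by rewrite big_const_ord iter_addr addr0 mulr_natl.
Qed.

End Orbit.

(** To come close to [z], choose a target close to [z / c], where [c] is the
    lowest coefficient, and a late step with that target and the base and degree
    attached to [P]. *)
Lemma generic_orbit (G : nat -> X) :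
  (forall i u, G i u = code_val R (target i) u + gen_tail i u) ->
  forall (d : nat) (sigma : 'I_d -> nat) (P : mpoly.mpoly d R[i]) (f : X),
  injective sigma -> P != 0 -> mpoly.mcoeff mpoly.mnm0 P = 0 ->
  (forall v, f v = mpoly.meval (fun i => G (sigma i) v) P) ->
  forall (z : X) (r : R), 0 < r -> exists n, nrm (iter n T f - z) < r.
Proof.
move=> GE d sigma P f sI P0 Pc fE z r r0.
have [D [m [c [K [D0 m0 c0 K0 PK]]]]] := kronecker_lowest_term sI P0 Pc.
have nc0 : 0 < normc c.
  by rewrite lt0r normc_ge0 andbT; apply: contra_neq c0; exact: eq0_normc.
have r20 : 0 < r / 2 by rewrite divr_gt0.
have [l hl] := code_fun_dense (c^-1 *: z) (divr_gt0 r20 nc0).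
pose B := \sum_(i < d) nrm (G (sigma i)).
have B0 : 0 <= B by apply: sumr_ge0 => i _; exact: nrm_ge0.
have [K2 K20 fK2] := meval_le Pc B0.
have fK v : normc (f v) <= K2 * \sum_i normc (G (sigma i) v).
  rewrite fE; apply: fK2 => i; apply: le_trans (coord_le_nrm _ _) _.
  by rewrite /B (bigD1 i)//= lerDl sumr_ge0// => j _; exact: nrm_ge0.
pose Y := \sum_(v <- undup (code_supp l)) normc (code_val R l v).
have Y0 : 0 <= Y by apply: sumr_ge0 => v _; exact: normc_ge0.
have [||N hN] := @half_pow_small R (nrm f + K * Y + K2 * d%:R) (r / 2) => //.
  by rewrite !addr_ge0 ?mulr_ge0 ?nrm_ge0.
have [k Nk ek] := e_often (D.-1, m.-1, l) (maxn N (\max_i sigma i).+1).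
move: Nk; rewrite geq_max => /andP[/hN small ksigma].
have sk i : (sigma i < k)%N by apply: leq_trans ksigma; rewrite ltnS leq_bigmax.
have kD : base k = D by rewrite /base ek prednK.
have km : deg k = m by rewrite /deg ek prednK.
have kl : target k = l by rewrite /target ek.
exists (time k).
have h1 := past_part f k.
have h2 := @block_part _ GE _ _ _ _ fE k c K K0 sk.
rewrite kD km kl in h2; have {}h2 := h2 PK.
have h3 := tail_part GE K20 sk fK.
have -> : iter (time k) T f - z =
    (iter (time k) T (restr s (past k) f) +
     iter (time k) T (f - restr s (past k) f - restr s (block k) f)) +
    ((iter (time k) T (restr s (block k) f) - c *: code_fun s l) +
     c *: (code_fun s l - c^-1 *: z)).
  have tele (a p b y x : X) : a - x = (p + (a - p - b)) + ((b - y) + (y - x)).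
    by rewrite [p + _]addrA [p + (a - p)]addrC subrK !subrKA.
  by rewrite scalerBr scalerA mulfV// scale1r !iterTB; exact: tele.
have h4 : nrm (c *: (code_fun s l - c^-1 *: z)) < r / 2.
  by rewrite nrmZ mulrC -ltr_pdivlMr.
apply: le_lt_trans (nrmD _ _) _.
have := nrmD (iter (time k) T (restr s (past k) f)) (iter (time k) T (f - restr s (past k) f - restr s (block k) f)).
have := nrmD (iter (time k) T (restr s (block k) f) - c *: code_fun s l) (c *: (code_fun s l - c^-1 *: z)).
move: small h1 h2 h3 h4; rewrite /supp kl -/Y !mulrDr; lra.
Qed.

End Construction.

(** * The generated algebra *)

Section Support.
Context (R : realType) (V : countType) (s : space_kind R).
Notation X := (tree_space V s).
Variable T : {linear X -> X}.

Lemma mpoly_widen d d' (le : (d <= d')%N) (P : mpoly.mpoly d R[i]) :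
  exists Q : mpoly.mpoly d' R[i], forall g : nat -> R[i],
    mpoly.meval (fun i => g (val i)) Q = mpoly.meval (fun i => g (val i)) P.
Proof.
pose lq := [tuple mpoly.mpolyX R[i] (mpoly.mnm1 (widen_ord le i)) | i < d].
exists (mpoly.comp_mpoly lq P) => g.
rewrite mpoly.comp_mpoly_meval; apply: mpoly.meval_eq => i.
by rewrite tnth_mktuple mpoly.mevalXU.
Qed.

Lemma iterT0 n : iter n T 0 = 0.
Proof. by elim: n => //= n ->; rewrite linear0. Qed.

Lemma zero_orbit (v1 : V) :
  ~ (forall (z : X) (r : R), 0 < r -> exists n, nrm (iter n T 0 - z) < r).
Proof.
move=> /(_ (delta s v1) 1 ltr01)[n]; rewrite iterT0 sub0r nrmN.
have := coord_le_nrm (delta s v1) v1; rewrite coord_delta eqxx normc1; lra.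
Qed.

Variable G : nat -> X.
Hypothesis G_dense : forall (z : X) (r : R), 0 < r -> exists i, nrm (G i - z) < r.
Hypothesis G_orbit : forall (d : nat) (sigma : 'I_d -> nat)
    (P : mpoly.mpoly d R[i]) (f : X),
  injective sigma -> P != 0 -> mpoly.mcoeff mpoly.mnm0 P = 0 ->
  (forall v, f v = mpoly.meval (fun i => G (sigma i) v) P) ->
  forall (z : X) (r : R), 0 < r -> exists n, nrm (iter n T f - z) < r.
Variable v1 : V.

Definition polynomial_in_G (f : X) := exists (d : nat) (P : mpoly.mpoly d R[i]),
  mpoly.meval (fun=> 0) P = 0 /\
  forall v, f v = mpoly.meval (fun i : 'I_d => G (val i) v) P.

Lemma polynomial_common (f g : X) : polynomial_in_G f -> polynomial_in_G g ->
  exists (d : nat) (P Q : mpoly.mpoly d R[i]),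
  [/\ mpoly.meval (fun=> 0) P = 0, mpoly.meval (fun=> 0) Q = 0,
      (forall v, f v = mpoly.meval (fun i : 'I_d => G (val i) v) P) &
      (forall v, g v = mpoly.meval (fun i : 'I_d => G (val i) v) Q)].
Proof.
move=> [d [P [P0 fP]]] [d' [Q [Q0 gQ]]].
have [P' hP] := mpoly_widen (leq_maxl d d') P.
have [Q' hQ] := mpoly_widen (leq_maxr d d') Q.
exists (maxn d d'), P', Q'; split.
- exact: etrans (hP (fun=> 0)) P0.
- exact: etrans (hQ (fun=> 0)) Q0.
- by move=> v; rewrite fP -(hP (fun i => G i v)).
- by move=> v; rewrite gQ -(hQ (fun i => G i v)).
Qed.

Lemma polynomial_subalgebra : subalgebra polynomial_in_G.
Proof.
split=> [|z f g /polynomial_common H /H[d [P [Q [P0 Q0 fP gQ]]]]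
         |f g /polynomial_common H /H[d [P [Q [P0 Q0 fP gQ]]]]].
- by exists 0%N, 0; split=> [|v]; rewrite mpoly.meval0.
- exists d, (z *: P + Q); split=> [|v]; rewrite mpoly.mevalD mpoly.mevalZ.
    by rewrite P0 Q0 mulr0 addr0.
  by rewrite coordD coordZ fP gQ.
- exists d, (P * Q); split=> [|v]; rewrite mpoly.mevalM; first by rewrite P0 mul0r.
  by rewrite -fP -gQ.
Qed.

Lemma G_polynomial i : polynomial_in_G (G i).
Proof.
exists i.+1, (mpoly.mpolyX R[i] (mpoly.mnm1 ord_max)).
by split=> [|v]; rewrite mpoly.mevalXU.
Qed.

Lemma generated_polynomial f : generated_algebra (range G) f -> polynomial_in_G f.
Proof.
move=> /(_ polynomial_in_G); apply; split; first exact: polynomial_subalgebra.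
by move=> _ [i _ <-]; exact: G_polynomial.
Qed.

Lemma orbit_hypercyclic (f : X) :
  (forall (z : X) (r : R), 0 < r -> exists n, nrm (iter n T f - z) < r) ->
  hypercyclic_vectors T f.
Proof.
move=> H O [z Oz] oO; have [r r0 hO] := open_nrm oO Oz.
have [n hn] := H z r r0; exists (iter n T f); split; first exact: hO.
by exists n.
Qed.

Lemma generated_subalgebra : subalgebra (generated_algebra (range G)).
Proof.
split=> [A [[A0 _ _] _] //|z f g Af Ag A [sA GA]|f g Af Ag A [sA GA]].
- by have [_ h _] := sA; apply: h; [apply: Af|apply: Ag].
- by have [_ _ h] := sA; apply: h; [apply: Af|apply: Ag].
Qed.

Lemma G_generated i : generated_algebra (range G) (G i).
Proof. by move=> A [_ GA]; apply: GA; exists i. Qed.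

(** A polynomial relation would give the vector 0 a dense orbit. *)
Lemma G_algebraically_independent : algebraically_independent (range G).
Proof.
move=> d g d0 gI gG P P0 Pn0 Pg.
have [sigma hs] : exists sigma : 'I_d -> nat, forall i, G (sigma i) = g i.
  have /choice[sigma hs] : forall i, exists j, G j = g i.
    by move=> i; have [j _ <-] := gG i; exists j.
  by exists sigma.
apply: (zero_orbit v1); apply: (@G_orbit d sigma P) => //.
  by move=> i j ij; apply: gI; rewrite -!hs ij.
move=> v; have /(congr1 (fun h => h v)) := Pg.
by under mpoly.meval_eq do rewrite -hs.
Qed.

(** Apply the orbit property to the polynomial [X_0 - X_1]. *)
Lemma G_inj : injective G.
Proof.
move=> i j Gij; apply: contrapT => ij.
pose P : mpoly.mpoly 2 R[i] :=
  mpoly.mpolyX R[i] (mpoly.mnm1 ord0) - mpoly.mpolyX R[i] (mpoly.mnm1 ord_max).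
apply: (zero_orbit v1).
apply: (@G_orbit 2 (fun k => if k == ord0 then i else j) P).
- move=> a b; have [->|a0] := eqVneq a ord0; have [->|b0] := eqVneq b ord0 => //.
  + by move=> h; case: (ij (esym h)).
  + by move: a b a0 b0 => [[|[|a]] ha] [[|[|b]] hb] //= _ _ _; exact: val_inj.
- apply/eqP => /(congr1 (mpoly.meval (fun k : 'I_2 => (k == ord0)%:R))).
  rewrite mpoly.mevalB !mpoly.mevalXU mpoly.meval0/= subr0 => /eqP.
  by rewrite oner_eq0.
- by rewrite -meval_at0 mpoly.mevalB !mpoly.mevalXU subrr.
- by move=> v; rewrite mpoly.mevalB !mpoly.mevalXU/= Gij subrr.
Qed.

Lemma supports_generated : supports_dense_free_hypercyclic_algebra T.
Proof.
exists (generated_algebra (range G)); split.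
- split; first exact: generated_subalgebra.
    move=> A0; have : [set 0] (G 0%N) by rewrite -A0; exact: G_generated.
    move=> G0; apply: (zero_orbit v1).
    apply: (@G_orbit 1 (fun=> 0%N) (mpoly.mpolyX R[i] (mpoly.mnm1 ord0))).
    + by move=> a b _; rewrite (ord1 a) (ord1 b).
    + apply/eqP => /(congr1 (mpoly.meval (fun=> 1))).
      by rewrite mpoly.mevalXU mpoly.meval0 => /eqP; rewrite oner_eq0.
    + by rewrite -meval_at0 mpoly.mevalXU.
    + by move=> v; rewrite mpoly.mevalXU G0.
  move=> f /generated_polynomial[d [P [P0 fP]]].
  have [PE|Pn0] := eqVneq P 0.
    by right; apply: space_ext => v; rewrite fP PE mpoly.meval0.
  left; apply: orbit_hypercyclic; apply: (G_orbit _ Pn0 _ fP); first exact: val_inj.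
  by rewrite -meval_at0.
- move=> O [z Oz] oO; have [r r0 hO] := open_nrm oO Oz.
  have [i hi] := G_dense z r0; exists (G i); split; first exact: hO.
  exact: G_generated.
- exists (range G); split=> //; last exact: G_algebraically_independent.
  by apply: inj_card_eq => i j _ _; exact: G_inj.
Qed.

End Support.

(** * Dynamics of shifts with growing branches *)

Section Dynamics.
Context (R : realType) (V : countType) (s : space_kind R).
Notation X := (tree_space V s).
Variables (T : {linear X -> X}) (up : nat -> V -> option V).
Variables (w : nat -> V -> R) (S : nat -> V -> V) (C : R).
Hypothesis T_delta : forall n u, iter n T (delta s u) =
  if up n u is Some v then (w n u)%:C *: delta s v else 0.
Hypothesis up_S : forall n v, up n (S n v) = Some v.
Hypothesis w_ge0 : forall n u, 0 <= w n u.
Hypothesis w_to0 : forall u (e : R), 0 < e ->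
  exists N, forall n, (N <= n)%N -> w n u <= e.

Lemma supports_algebra (v1 : V) : 1 <= C ->
  (forall f : X, nrm (T f) <= C * nrm f) ->
  (forall (A : seq V) (K : R) N,
     exists2 n, (N <= n)%N & forall v, v \in A -> K <= w n (S n v)) ->
  supports_dense_free_hypercyclic_algebra T.
Proof.
move=> C1 T_le w_large.
have [e e_often] := @infinitely_often (nat * nat * seq (V * (rat * rat)))%type (0%N, 0%N, [::]).
have gen := @generator_exists R V s up w S C up_S C1 w_to0 w_large e.
have [G hG] := choice gen.
apply: (@supports_generated R V s T G _ _ v1) => [z r r0|].
  have r20 : 0 < r / 2 by rewrite divr_gt0.
  have [l hl] := code_fun_dense z r20.
  have [N hN] := half_pow_small ler01 r20.
  have [k /hN + ek] := e_often (0%N, 0%N, l) N; rewrite mulr1 => k2; exists k.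
  have := (hG k).2; rewrite /target ek/= => Gk.
  have := nrmD (G k - code_fun s l) (code_fun s l - z); rewrite subrKA; lra.
apply: (@generic_orbit R V s T up w S C T_delta up_S w_ge0 C1 T_le w_to0 w_large e e_often).
by move=> i u; exact: (hG i).1.
Qed.

(** Given [x] and [y] of finite support, add to [x] the values [y v / w n (S n v)]
    at the descendants [S n v]: this small perturbation is mapped to [y] by
    [T^n], while [T^n x] tends to 0. *)
Lemma shift_mixing :
  (forall (A : seq V) (K : R),
     exists N, forall n, (N <= n)%N -> forall v, v \in A -> K <= w n (S n v)) ->
  mixing T.
Proof.
move=> w_large U W oU oW [x Ux] [y Wy].
have [r r0 hU] := open_nrm oU Ux; have [q q0 hW] := open_nrm oW Wy.
have r20 : 0 < r / 2 by rewrite divr_gt0.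
have q20 : 0 < q / 2 by rewrite divr_gt0.
have [A hA] := restr_dense x r20; have [B hB] := restr_dense y q20.
have x1 : 0 < nrm x + 1 by rewrite ltr_wpDl ?nrm_ge0.
pose Y := \sum_(v <- undup B) normc (y v).
have Y0 : 0 <= Y by apply: sumr_ge0 => v _; exact: normc_ge0.
have [N1 hN1] := sum_w_to0 w_to0 (undup A) (divr_gt0 q20 x1).
pose K := Y / (r / 2) + 1.
have K1 : 1 <= K by rewrite lerDr divr_ge0// ltW.
have [N2 hN2] := w_large B K.
exists (maxn N1 N2) => n; rewrite geq_max => /andP[/hN1 wA /hN2 wB].
pose b := \sum_(v <- undup B) (y v / (w n (S n v))%:C) *: delta s (S n v).
have w0 v : v \in B -> 0 < w n (S n v).
  by move=> /wB; apply: lt_le_trans; exact: lt_le_trans K1.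
have Tb : iter n T b = restr s B y.
  rewrite iterT_sum /restr big_seq [RHS]big_seq; apply: eq_bigr => v.
  rewrite mem_undup => vB; rewrite iterTZ T_delta up_S scalerA divfK//.
  by rewrite -[0](@complexr0 R) (inj_eq (@complexI R)) gt_eqF// w0.
have nb : nrm b < r / 2.
  apply: (@le_lt_trans _ _ (Y / K)).
    rewrite (le_trans (nrm_sum _ _))// mulr_suml big_seq [leRHS]big_seq.
    apply: ler_sum => v; rewrite mem_undup => vB; have wv := w0 _ vB.
    rewrite nrmZ -[leRHS]mulr1 ler_pM ?normc_ge0 ?nrm_ge0 ?nrm_delta//.
    rewrite normcM normcV normc_real gtr0_norm// ler_wpM2l ?normc_ge0//.
    by rewrite lef_pV2 ?posrE ?wB// (lt_le_trans _ K1).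
  rewrite ltr_pdivrMr ?(lt_le_trans _ K1)// mulrDr mulr1 mulrC divfK ?gt_eqF//.
  by rewrite ltrDl.
have Ta : nrm (iter n T (restr s A x)) <= q / 2.
  rewrite /restr iterT_sum (le_trans (nrm_sum _ _))//.
  apply: (@le_trans _ _ ((nrm x + 1) * (q / 2 / (nrm x + 1)))); last first.
    by rewrite mulrC divfK ?gt_eqF.
  apply: le_trans (ler_wpM2l (ltW x1) wA); rewrite mulr_sumr.
  apply: ler_sum => u _; rewrite iterTZ nrmZ ler_pM ?normc_ge0 ?nrm_ge0//.
    by rewrite (le_trans (coord_le_nrm _ _))// lerDl.
  rewrite T_delta; case: (up _ u) => [v|]; last by rewrite nrm0 w_ge0.
  by rewrite nrmZ normc_real ger0_norm ?w_ge0// ler_piMr ?w_ge0 ?nrm_delta.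
exists (iter n T (restr s A x + b)); split.
  exists (restr s A x + b) => //; apply: hU.
  have -> : restr s A x + b - x = b - (x - restr s A x) by rewrite opprB addrCA addrA addrC.
  by have := nrmB b (x - restr s A x); lra.
apply: hW; rewrite iterTD Tb.
have -> : iter n T (restr s A x) + restr s B y - y =
  iter n T (restr s A x) - (y - restr s B y) by rewrite opprB addrA.
by have := nrmB (iter n T (restr s A x)) (y - restr s B y); lra.
Qed.

End Dynamics.

(** * The shift on the tree *)

Section Assembly.
Context (R : realType) (V : countType) (E : rel V) (s : space_kind R).
Hypothesis dtE : directed_tree E.
Hypothesis leafE : leafless E.
Notation X := (tree_space V s).

Lemma shift_delta (lam : V -> R[i]) (T : {linear X -> X}) u :
  weighted_backward_shift E lam T ->
  T (delta s u) = if parent E u is Some v then lam u *: delta s v else 0.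
Proof.
move=> wbsT; apply: space_ext => v.
pose a x : R[i] := if E v x then lam x * delta s u x else 0.
have hs : has_sum a (\sum_(x <- [fset u]%fset) a x).
  apply: has_sum_fset => x; rewrite inE => xu.
  by rewrite /a coord_delta (negbTE xu) mulr0; case: ifP.
have -> : T (delta s u) v = \sum_(x <- [fset u]%fset) a x.
  have FF := fmap_proper_filter (summability.partial_sum (fun x => a x : R[i]^o))
    (@summability.totally_filter V).
  exact: (@cvg_unique _ (@norm_hausdorff _ R[i]^o) _ FF _ _
    (@wbs_sum _ _ _ _ _ _ wbsT (delta s u) v) (has_sum_cvg hs)).
rewrite big_seq_fset1 /a coord_delta eqxx mulr1.
case Pu : (parent E u) => [v'|]; last first.
  by case: ifPn => // /(parP dtE); rewrite Pu.
rewrite coordZ coord_delta; have [->|vv] := eqVneq v v'.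
  by have /(parP dtE) -> := Pu; rewrite mulr1.
rewrite mulr0; case: ifPn => // /(parP dtE); rewrite Pu => -[vE].
by rewrite vE eqxx in vv.
Qed.

Variables (v0 : V) (c : V -> V) (dep : V -> nat).
Hypothesis cE : forall v, E v (c v).
Hypothesis cline : forall v k, ancestor E k.+1 v0 = Some v -> ancestor E k v0 = Some (c v).
Hypothesis dep_below : forall v k, ancestor E k v = Some v0 -> dep v = k.
Hypothesis dep_out : forall v, ~ below E v0 v -> dep v = 0%N.
Variable d : nat -> R.
Hypothesis d1 : forall n, 1 <= d n.
Hypothesis dmono : forall m n, (m <= n)%N -> d m <= d n.

Let d0 n : 0 < d n. Proof. exact: lt_le_trans (d1 n). Qed.
Local Notation vertex_wt := (vertex_wt E v0 c dep d).
Local Notation path_wt := (path_wt E v0 c dep d).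

Lemma iter_shift_delta (T : {linear X -> X}) :
  weighted_backward_shift E (fun u => (vertex_wt u)%:C) T -> forall n u,
  iter n T (delta s u) =
  if ancestor E n u is Some v then (path_wt n u)%:C *: delta s v else 0.
Proof.
move=> wbsT; elim=> [|n IH] u; first by rewrite /= scale1r.
rewrite iterSr (shift_delta _ wbsT) /=; case: (parent E u) => [v|]; last exact: iterT0.
rewrite iterTZ IH; case: (ancestor E n v) => [x|]; last by rewrite scaler0.
by rewrite scalerA -rmorphM.
Qed.

(** The constants of finitely many branches are merged: [d] being nondecreasing,
    the largest shift of the argument gives the weakest bound. *)
Lemma path_wt_large (A : seq V) (K : R) : exists (B : R) (J N : nat), forall n,
  (N <= n)%N -> B <= 4 ^+ n / d (J + n) ->
  forall v, v \in A -> K <= path_wt n (iter n c v).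
Proof.
elim: A => [|v A [B [J [N IH]]]]; first by exists 0, 0%N, 0%N.
have [C [J' [N' [C0 hC]]]] := path_wt_branch dtE cE cline dep_below dep_out d1 dmono v.
exists (`|B| + `|K| / C), (maxn J J'), (maxn N N') => n.
rewrite geq_max => /andP[Nn Nn'] Bn.
have KC : 0 <= `|K| / C by rewrite divr_ge0// ltW.
have le_maxd j : (j <= maxn J J')%N ->
    4 ^+ n / d (maxn J J' + n) <= 4 ^+ n / d (j + n).
  move=> jJ; rewrite ler_wpM2l ?exprn_ge0// lef_pV2 ?posrE//.
  by rewrite dmono// leq_add2r.
move=> x; rewrite inE => /orP[/eqP->|xA]; last first.
  apply: (IH n Nn) => //; apply: le_trans (le_maxd J (leq_maxl _ _)).
  by apply: le_trans Bn; have := ler_norm B; lra.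
apply: le_trans (hC n Nn'); rewrite -mulrA mulrC -ler_pdivrMr//.
apply: le_trans (le_maxd J' (leq_maxr _ _)); apply: le_trans Bn.
have : K / C <= `|K| / C by rewrite ler_wpM2r ?invr_ge0 ?(ltW C0)// ler_norm.
by have := normr_ge0 B; lra.
Qed.

(** Each application of [T] uses the row bound at the current depth; the quotients
    of [d] telescope. *)
Lemma iter_shift_coord (T : {linear X -> X}) (f : X) (t : R) :
  (forall (g : X) v (r : R), 0 <= r -> (forall u, E v u -> normc (g u) <= r) ->
     normc (T g v) <= row_bound E v0 dep d v * r) ->
  0 <= t -> (forall u, normc (f u) <= t) ->
  forall n v k, ancestor E k v = Some v0 ->
  normc (iter n T f v) <= 8 ^+ n * d k / d (k + n) * t.
Proof.
move=> Trow t0 ft; elim=> [|n IH] v k kv.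
  by rewrite addn0 mul1r divff ?gt_eqF// mul1r.
rewrite iterS; apply: le_trans (Trow _ _ (8 ^+ n * d k.+1 / d (k.+1 + n) * t) _ _) _.
- by rewrite mulr_ge0// divr_ge0 ?mulr_ge0 ?exprn_ge0 ?(ltW (d0 _)).
- by move=> u /(parP dtE) uv; apply: IH; rewrite /= uv.
rewrite /row_bound; case: pselect => /= [_|[]]; last by exists k.
rewrite (dep_below kv) exprS addnS addSn le_eqVlt; apply/orP; left; apply/eqP.
by field; rewrite !gt_eqF.
Qed.

(** The times at which [d n >= 8^n] contradict mixing from the unit ball to a
    ball of vectors whose value at [v0] exceeds [d 0] in modulus. *)
Lemma tree_shift : (forall J (B : R) N, exists2 n, (N <= n)%N & B <= 4 ^+ n / d (J + n)) ->
  exists T : {linear X -> X},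
  [/\ weighted_backward_shift E (fun u => (vertex_wt u)%:C) T,
      supports_dense_free_hypercyclic_algebra T,
      (forall J (B : R), exists N, forall n, (N <= n)%N -> B <= 4 ^+ n / d (J + n)) ->
        mixing T &
      (forall N, exists2 n, (N <= n)%N & 8 ^+ n <= d n) -> ~ mixing T].
Proof.
move=> growth.
have [||||T [wbsT Trow TN]] := @exists_shift R V E s (fun u => (vertex_wt u)%:C)
  (row_bound E v0 dep d) 8 leafE (dtree_parent_unique dtE).
- by move=> v; rewrite -[0](@complexr0 R) (inj_eq (@complexI R)) gt_eqF// vertex_wt_gt0.
- by rewrite ltr0n.
- move=> v A uA; apply: le_trans (vertex_wt_row dtE cline dep_below dep_out d1 dmono v uA).
  apply: ler_sum => u _; case: ifP => // _.
  by rewrite normc_real ger0_norm// ltW// vertex_wt_gt0.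
- by move=> v; exact: row_bound_le.
have Tdelta := iter_shift_delta wbsT.
have up_S n v : ancestor E n (iter n c v) = Some v by exact: anc_iter_c.
have w0 n u : 0 <= path_wt n u by exact: path_wt_ge0.
have wto0 u (e : R) : 0 < e -> exists N, forall n, (N <= n)%N -> path_wt n u <= e.
  exact: path_wt_to0.
exists T; split=> //.
- apply: (supports_algebra Tdelta up_S w0 wto0 v0 _ TN) => [|A K N].
    by rewrite -natrM ler1n.
  have [B [J [N' h]]] := path_wt_large A K.
  have [n] := growth J B (maxn N N'); rewrite geq_max => /andP[Nn Nn'] Bn.
  by exists n => //; exact: h.
- move=> ev; apply: (shift_mixing Tdelta up_S w0 wto0) => A K.
  have [B [J [N' h]]] := path_wt_large A K; have [N hN] := ev J B.
  exists (maxn N N') => n; rewrite geq_max => /andP[/hN Bn Nn'].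
  exact: h.
- move=> big mixT; pose Q : R[i] := (d 0%N + 2)%:C.
  have [] := mixT _ _ (@nrm_ball_open R V s 0 1) (@nrm_ball_open R V s (Q *: delta s v0) 1).
  + by exists 0; rewrite /= subrr nrm0.
  + by exists (Q *: delta s v0); rewrite /= subrr nrm0.
  move=> N hN; have [n Nn dn] := big N.
  have [_ [[f f1 <-] /= gQ]] := hN n Nn.
  have f1' : nrm f <= 1 by move: f1; rewrite /= subr0 => /ltW.
  have := iter_shift_coord Trow ler01 (fun u => le_trans (coord_le_nrm f u) f1') n
    (erefl : ancestor E 0 v0 = Some v0).
  rewrite mulr1 add0n => up.
  have up' : normc (iter n T f v0) <= d 0%N.
    apply: le_trans up _; rewrite ler_pdivrMr// mulrC ler_wpM2l//.
    exact: ltW.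
  have := le_lt_trans (coord_le_nrm _ v0) gQ.
  rewrite coordB coordZ coord_delta eqxx mulr1.
  have : normc Q <= normc (iter n T f v0 - Q) + normc (iter n T f v0).
    move: (iter n T f v0) => x; have -> : normc Q = normc (- (x - Q) + x).
      by congr normc; ring.
    by rewrite (le_trans (le_normcD _ _))// normcN.
  rewrite normc_real ger0_norm ?addr_ge0 ?(ltW (d0 _))//.
  move: up'; lra.
Qed.

End Assembly.

(** The profile is constant on each interval from [2^i] to [2^(i+1) - 1]: at the
    left end it equals [8^n], and at the right end only about [8^(n/2)], which
    [4^n] beats. *)
Lemma oscillating_profile (R : realType) : exists d : nat -> R,
  [/\ (forall n, 1 <= d n), (forall m n, (m <= n)%N -> d m <= d n),
      (forall J (B : R) N, exists2 n, (N <= n)%N & B <= 4 ^+ n / d (J + n)%N) &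
      (forall N, exists2 n, (N <= n)%N & 8 ^+ n <= d n)].
Proof.
exists (fun n => 8 ^+ (2 ^ trunc_log 2 n)); split.
- by move=> n; rewrite exprn_ege1// ler1n.
- move=> m n mn; rewrite ler_weXn2l ?ler1n// leq_exp2l//.
  exact: leq_trunc_log.
- move=> J B N; have [N' hN'] := four_pow_large (B * 4 ^+ J.+1).
  (* [J + n] is the last argument at which the profile is [8 ^ 2 ^ i]. *)
  pose i := (maxn N N' + J.+1)%N; pose n := (2 ^ i.+1 - J.+1)%N.
  have i2 : (i < 2 ^ i)%N by exact: ltn_expl.
  have ni : (i <= n)%N by rewrite /n expnS mul2n -addnn; lia.
  exists n; first by apply: leq_trans ni; rewrite /i; lia.
  have nJ : (J + n = (2 ^ i.+1).-1)%N by rewrite /n expnS mul2n -addnn; lia.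
  have -> : trunc_log 2 (J + n) = i.
    apply: trunc_log_eq => //; rewrite nJ expnS mul2n -addnn; lia.
  rewrite ler_pdivlMr ?exprn_gt0// -(@ler_pM2r _ (4 ^+ J.+1)) ?exprn_gt0//.
  have iE : i = i.-1.+1 by rewrite /i; lia.
  have big : B * 4 ^+ J.+1 <= 4 ^+ (2 ^ i.-1).
    by apply: hN'; apply: leq_trans (ltnW (ltn_expl _ _)) => //; rewrite /i; lia.
  have -> : 4 ^+ n * 4 ^+ J.+1 = 4 ^+ (2 ^ i.-1) * 8 ^+ (2 ^ i) :> R.
    rewrite -exprD /n subnK; last by rewrite expnS mul2n -addnn; lia.
    rewrite iE /= !expnS !exprM -exprMn; congr (_ ^+ _); ring.
  by rewrite mulrAC ler_wpM2r// exprn_ge0.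
- move=> N; exists (2 ^ N)%N; first exact/ltnW/ltn_expl.
  by rewrite trunc_expnK.
Qed.

Local Close Scope complex_scope.
Local Close Scope classical_set_scope.

Theorem theorem5p1 (R : realType) (V : countType) (E : rel V)
    (dtE : directed_tree E) (leaflessE : leafless E) (s : space_kind R) :
  (exists (lam : V -> R[i]) (T : {linear tree_space V s -> tree_space V s}),
    [/\ weighted_backward_shift E lam T, mixing T &
        supports_dense_free_hypercyclic_algebra T]) /\
  (exists (lam : V -> R[i]) (T : {linear tree_space V s -> tree_space V s}),
    [/\ weighted_backward_shift E lam T, ~ mixing T &
        supports_dense_free_hypercyclic_algebra T]).
Proof.
have [v0 _] := dtree_nonempty dtE.
have [c [cE cline]] := exists_child_choice dtE leaflessE v0.
have [dep [dep_below dep_out]] := exists_depth dtE v0.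
split.
  have ev (J : nat) (B : R) : exists N, forall n, (N <= n)%N -> B <= 4 ^+ n / 1.
    by have [N hN] := four_pow_large B; exists N => n /hN; rewrite divr1.
  have [||J B N|T [wbsT supT mixT _]] := @tree_shift R V E s dtE leaflessE v0 c dep
    cE cline dep_below dep_out (fun=> 1).
  - by [].
  - by [].
  - have [N' hN] := ev J B; exists (maxn N N'); first exact: leq_maxl.
    by apply: hN; exact: leq_maxr.
  - by eexists _, T; split; [exact: wbsT|exact: mixT|].
have [d [d1 dmono growth big]] := oscillating_profile R.
have [T [wbsT supT _ nmixT]] := @tree_shift R V E s dtE leaflessE v0 c dep
  cE cline dep_below dep_out d d1 dmono growth.
by eexists _, T; split; [exact: wbsT|exact: nmixT|].
Qed.
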